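(* Let $L$ be a finitely generated $R$-module and $I$ an ideal of $R$. Then, for almost all $\alpha$, (i) $\operatorname{grade}(I_\alpha,L_\alpha)=\operatorname{grade}(I,L)$; (ii) $\operatorname{grade}L_\alpha=\operatorname{grade}L$.
   Context: Let $k$ be an arbitrary infinite field, $u=(u_1,\ldots,u_m)$ and $x=(x_1,\ldots,x_n)$ indeterminates, and $R=k(u)[x]$. Let $K$ be an extension field of $k$; for $\alpha\in K^m$ put $R_\alpha=k(\alpha)[x]$. A property holds for almost all $\alpha$ if it holds for all $\alpha\in K^m$ except perhaps those lying on a proper algebraic subvariety of $K^m$ (which may depend on the given data). Every $a\in R$ can be written $a(u,x)=p(u,x)/q(u)$ with $p\in k[u,x]$, $q\in k[u]\setminus\{0\}$; for $\alpha$ with $q(\alpha)\neq 0$ put $a(\alpha,x)=p(\alpha,x)/q(\alpha)\in R_\alpha$. For a matrix $A=(a_{ij}(u,x))$ over $R$ put $A_\alpha=(a_{ij}(\alpha,x))$; this is defined for almost all $\alpha$. The specialization $F_\alpha$ of a free $R$-module $F$ of finite rank is a free $R_\alpha$-module of the same rank. With bases fixed, the specialization $\phi_\alpha:F_\alpha\to G_\alpha$ of a homomorphism $\phi:F\to G$ of free $R$-modules of finite ranks with matrix $A$ is the homomorphism with matrix $A_\alpha$. Each finitely generated $R$-module $L$ is considered together with a fixed (arbitrary) finite free presentation $F_1\xrightarrow{\phi}F_0\to L\to 0$ (free modules of finite ranks), and its specialization is $L_\alpha:=\operatorname{Coker}\phi_\alpha$. For an ideal $I$ of $R$, the specialization $I_\alpha$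 is the ideal of $R_\alpha$ generated by $\{f(\alpha,x)\mid f(u,x)\in I\cap k[u,x]\}$. For a finitely generated module $L$ and an ideal $I$ over a Noetherian ring $S$ ($S=R$ or $R_\alpha$): $\operatorname{grade}(I,L)$ is the maximal length of regular $L$-sequences in $I$ if $L\neq IL$, and $\operatorname{grade}(I,L)=\infty$ if $L=IL$. Moreover $\operatorname{grade}L:=\operatorname{grade}(\operatorname{Ann}L,S)$. *)

(* Defs.v *)
From HB Require Import structures.
From mathcomp Require Import all_boot all_order all_algebra.
From mathcomp.classical Require Import boolp.
From mathcomp Require Import mpoly.

Set Implicit Arguments.
Unset Strict Implicit.
Unset Printing Implicit Defensive.

Import GRing.Theory.
Local Open Scope ring_scope.
Local Open Scope quotient_scope.

Definition infinite_field (k : fieldType) : Prop :=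
  forall s : seq k, exists x : k, x \notin s.

Section Adjoin.
Variables (k K : fieldType) (iota : {rmorphism k -> K}).
Variables (m : nat) (alpha : 'I_m -> K).

Definition eval_at (f : {mpoly k[m]}) : K := (map_mpoly iota f).@[alpha].

Fact eval_at_zmod_morphism : zmod_morphism eval_at.
Proof. by move=> f g; rewrite /eval_at !rmorphB. Qed.
Fact eval_at_monoid_morphism : monoid_morphism eval_at.
Proof. by split=> [|f g]; rewrite /eval_at ?rmorph1 ?rmorphM. Qed.
HB.instance Definition _ :=
  GRing.isZmodMorphism.Build {mpoly k[m]} K eval_at eval_at_zmod_morphism.
HB.instance Definition _ :=
  GRing.isMonoidMorphism.Build {mpoly k[m]} K eval_at eval_at_monoid_morphism.

(* k(alpha) = { p(alpha) / q(alpha) | q(alpha) <> 0 }; membership is made boolean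
   classically so that k(alpha) is a subtype of K with its field structure. *)
Definition adjoin_pred : {pred K} := fun z =>
  `[< exists p q : {mpoly k[m]}, eval_at q != 0 /\ z = eval_at p / eval_at q >].

Fact adjoin_divring_closed : divring_closed adjoin_pred.
Proof.
split.
- apply/asboolP; exists 1, 1.
  by rewrite rmorph1 oner_eq0 divr1.
- move=> x y /asboolP[p [q [q0 ->]]] /asboolP[r [s [s0 ->]]].
  apply/asboolP; exists (p * s - r * q), (q * s).
  by rewrite rmorphB !rmorphM mulf_neq0 // -[- (_ / _)]mulNr addf_div // mulNr.
- move=> x y /asboolP[p [q [q0 ->]]] /asboolP[r [s [s0 ->]]].
  apply/asboolP; have [r0|r0] := eqVneq (eval_at r) 0.
    by exists 0, 1; rewrite r0 mul0r invr0 mulr0 rmorph0 rmorph1 oner_eq0 mul0r.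
  exists (p * s), (q * r).
  by rewrite !rmorphM mulf_neq0 // invf_div mulf_div.
Qed.
HB.instance Definition _ :=
  GRing.isDivringClosed.Build K adjoin_pred adjoin_divring_closed.

Record adjoin : Type := Adjoin {adjoin_val : K; _ : adjoin_val \in adjoin_pred}.
HB.instance Definition _ := [isSub for adjoin_val].
HB.instance Definition _ := [Choice of adjoin by <:].
HB.instance Definition _ := [SubChoice_isSubIntegralDomain of adjoin by <:].
HB.instance Definition _ := [SubIntegralDomain_isSubField of adjoin by <:].

Fact eval_at_adjoin (f : {mpoly k[m]}) : eval_at f \in adjoin_pred.
Proof.
by apply/asboolP; exists f, 1; rewrite rmorph1 oner_eq0 divr1.
Qed.

Definition eval_adjoin (f : {mpoly k[m]}) : adjoin := Adjoin (eval_at_adjoin f).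

Fact eval_adjoin_zmod_morphism : zmod_morphism eval_adjoin.
Proof. by move=> f g; apply: val_inj; rewrite /= rmorphB. Qed.
Fact eval_adjoin_monoid_morphism : monoid_morphism eval_adjoin.
Proof. by split=> [|f g]; apply: val_inj; rewrite /= ?rmorph1 ?rmorphM. Qed.
HB.instance Definition _ := GRing.isZmodMorphism.Build
  {mpoly k[m]} adjoin eval_adjoin eval_adjoin_zmod_morphism.
HB.instance Definition _ := GRing.isMonoidMorphism.Build
  {mpoly k[m]} adjoin eval_adjoin eval_adjoin_monoid_morphism.

End Adjoin.

Section Coker.
Variables (S : nzRingType) (U V : lmodType S) (f : {linear U -> V}).

Definition im_pred : {pred V} := fun v => `[< exists u, f u = v >].

Fact im_submod_closed : submod_closed im_pred.
Proof.
split=> [|a x y /asboolP[u <-] /asboolP[v <-]]; apply/asboolP.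
  by exists 0; rewrite linear0.
by exists (a *: u + v); rewrite linearP.
Qed.
HB.instance Definition _ :=
  GRing.isSubmodClosed.Build S V im_pred im_submod_closed.

Definition coker : Type := Quotient.quot im_pred.
HB.instance Definition _ := GRing.Zmodule.on coker.

Definition coker_pi (v : V) : coker := \pi_(Quotient.quot im_pred) v.
Definition coker_scale (a : S) (x : coker) : coker :=
  coker_pi (a *: repr (x : Quotient.quot im_pred)).

Fact coker_scale_pi a v : coker_scale a (coker_pi v) = coker_pi (a *: v).
Proof.
apply/eqP; rewrite /coker_scale /coker_pi -Quotient.idealrBE -scalerBr.
by apply: rpredZ; rewrite Quotient.idealrBE reprK.
Qed.

Fact coker_piD v w : coker_pi (v + w) = coker_pi v + coker_pi w.
Proof. exact: (raddfD (\pi_(Quotient.quot im_pred))). Qed.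

Fact coker_pi_surj x : exists v, x = coker_pi v.
Proof. by exists (repr (x : Quotient.quot im_pred)); rewrite /coker_pi reprK. Qed.

Fact coker_pi_eq0 v : coker_pi v = 0 <-> exists u, f u = v.
Proof.
have -> : (0 : coker) = coker_pi 0.
  by apply: (addrI (coker_pi v)); rewrite -coker_piD !addr0.
rewrite /coker_pi; split=> [/eqP|[u <-]].
  by rewrite -Quotient.idealrBE subr0 => /asboolP.
by apply/eqP; rewrite -Quotient.idealrBE subr0; apply/asboolP; exists u.
Qed.

Fact coker_scaleA a b x :
  coker_scale a (coker_scale b x) = coker_scale (a * b) x.
Proof. by have [v ->] := coker_pi_surj x; rewrite !coker_scale_pi scalerA. Qed.
Fact coker_scale1 : left_id 1 coker_scale.
Proof.
by move=> x; have [v ->] := coker_pi_surj x; rewrite coker_scale_pi scale1r.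
Qed.
Fact coker_scaleDr : right_distributive coker_scale +%R.
Proof.
move=> a x y; have [v ->] := coker_pi_surj x; have [w ->] := coker_pi_surj y.
by rewrite -coker_piD !coker_scale_pi -coker_piD scalerDr.
Qed.
Fact coker_scaleDl x :
  {morph (fun a => coker_scale a x) : a b / a + b}.
Proof.
move=> a b; have [v ->] := coker_pi_surj x.
by rewrite !coker_scale_pi -coker_piD scalerDl.
Qed.
HB.instance Definition _ := GRing.Zmodule_isLmodule.Build S coker
  coker_scaleA coker_scale1 coker_scaleDr coker_scaleDl.

End Coker.

Section Grade.
Variable S : comNzRingType.
Implicit Types (I G : S -> Prop) (L : lmodType S).

Definition is_ideal I : Prop :=
  [/\ I 0, forall a b, I a -> I b -> I (a + b) & forall a b, I b -> I (a * b)].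

Definition ideal_gen G (x : S) : Prop :=
  exists (r : nat) (c g : 'I_r -> S),
    (forall i, G (g i)) /\ x = \sum_(i < r) c i * g i.

Definition ideal_mul I L (v : L) : Prop :=
  exists (r : nat) (a : 'I_r -> S) (w : 'I_r -> L),
    (forall i, I (a i)) /\ v = \sum_(i < r) a i *: w i.

Definition seq_mul (s : seq S) L (v : L) : Prop :=
  ideal_mul (ideal_gen (fun x => x \in s)) v.

(* The second clause says that s`_i is a nonzerodivisor on the quotient
   L / (s_0, ..., s_(i-1)) L. *)
Definition regular_seq L (s : seq S) : Prop :=
  ~ (forall v : L, seq_mul s v) /\
  forall i, (i < size s)%N ->
    forall v : L, seq_mul (take i s) (s`_i *: v) -> seq_mul (take i s) v.

Definition regular_seq_in I L (s : seq S) : Prop :=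
  (forall a, a \in s -> I a) /\ regular_seq L s.

Definition max_regular_length I L (d : nat) : Prop :=
  (exists2 s, regular_seq_in I L s & size s = d) /\
  (forall s, regular_seq_in I L s -> (size s <= d)%N).

(* [None] stands for infinity.  For S Noetherian and L finitely generated with
   L <> IL the lengths are bounded, so [None] then means exactly L = IL. *)
Definition grade I L : option nat :=
  match pselect (forall v : L, ideal_mul I v) with
  | left _ => None
  | right _ =>
    match pselect (exists d, max_regular_length I L d) with
    | left h => Some (sval (cid h))
    | right _ => None
    end
  end.

Definition Ann L (a : S) : Prop := forall v : L, a *: v = 0.

Definition grade_module L : option nat := grade (Ann L) (S^o : lmodType S).

Definition free_presentation (p q : nat) L
    (phi : {linear 'rV[S]_q -> 'rV[S]_p}) (pi : {linear 'rV[S]_p -> L}) : Prop :=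
  (forall y : L, exists v, pi v = y) /\
  (forall v, pi v = 0 <-> exists w, phi w = v).

End Grade.


(* R = k(u)[x] *)
Notation gen_ring k m n := {mpoly {fraction {mpoly k[m]}}[n]}.
(* R_alpha = k(alpha)[x] *)
Notation spec_ring iota alpha n := {mpoly (adjoin iota alpha)[n]}.

Fact eq_scaleV (F : fieldType) (V : lmodType F) (a b : F) (v w : V) :
  a != 0 -> b != 0 -> a^-1 *: v = b^-1 *: w <-> b *: v = a *: w.
Proof.
move=> a0 b0; split=> eqvw.
  by rewrite -[v](scalerKV a0) eqvw !scalerA mulrAC divff ?mul1r.
by rewrite -[v](scalerK b0) eqvw !scalerA mulrAC mulVf ?mul1r.
Qed.

Fact map_mpoly_inj (n : nat) (A B : nzRingType) (f : {rmorphism A -> B}) :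
  injective f -> injective (map_mpoly (n := n) f).
Proof.
move=> f_inj v w eqvw; apply/mpolyP=> i; apply: f_inj.
by rewrite -!mcoeff_map_mpoly eqvw.
Qed.

Section Specialization.
Variables (k K : fieldType) (iota : {rmorphism k -> K}) (m n : nat).

Definition gen_incl (f : {mpoly {mpoly k[m]}[n]}) : gen_ring k m n :=
  map_mpoly (@tofrac {mpoly k[m]}) f.

Variable alpha : 'I_m -> K.

Definition eval_poly (f : {mpoly {mpoly k[m]}[n]}) : spec_ring iota alpha n :=
  map_mpoly (eval_adjoin iota alpha) f.

(* [b] is a(alpha,x) = p(alpha,x) / q(alpha), for some writing
   a = p(u,x) / q(u) with q(alpha) <> 0. *)
Definition is_spec (a : gen_ring k m n) (b : spec_ring iota alpha n) : Prop :=
  exists (p : {mpoly {mpoly k[m]}[n]}) (q : {mpoly k[m]}),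
    [/\ eval_adjoin iota alpha q != 0,
        a = (tofrac q)^-1 *: gen_incl p
      & b = (eval_adjoin iota alpha q)^-1 *: eval_poly p].

Fact is_spec_uniq a b b' : is_spec a b -> is_spec a b' -> b = b'.
Proof.
move=> [p [q [q0 -> ->]]] [p' [q' [q'0 + ->]]].
have nz (r : {mpoly k[m]}) : eval_adjoin iota alpha r != 0 -> tofrac r != 0.
  by apply: contra_neq => /eqP; rewrite tofrac_eq0 => /eqP->; rewrite rmorph0.
move/(eq_scaleV _ _ (nz _ q0) (nz _ q'0)) => eqpq.
apply/(eq_scaleV _ _ q0 q'0).
have {}eqpq : q' *: p = q *: p'.
  apply: (map_mpoly_inj (f := @tofrac {mpoly k[m]})).
    by move=> x y /eqP; rewrite tofrac_eq => /eqP.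
  by rewrite !map_mpolyZ.
by move: (congr1 eval_poly eqpq); rewrite /eval_poly !map_mpolyZ.
Qed.

Definition spec_def (a : gen_ring k m n) : Prop := exists b, is_spec a b.

(* a(alpha,x), with the dummy value 0 where it is not defined *)
Definition spec (a : gen_ring k m n) : spec_ring iota alpha n :=
  match pselect (spec_def a) with
  | left h => sval (cid h)
  | right _ => 0
  end.

Definition spec_ideal (I : gen_ring k m n -> Prop) :
    spec_ring iota alpha n -> Prop :=
  ideal_gen (fun b => exists2 f, I (gen_incl f) & b = eval_poly f).

Variables (p q : nat).
Variable phi : {linear 'rV[gen_ring k m n]_q -> 'rV[gen_ring k m n]_p}.

Definition spec_hom_def : Prop := forall i j, spec_def (lin1_mx phi i j).

(* MathComp matrices act on row vectors: phi v = v *m lin1_mx phi. *)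
Definition spec_hom :
    {linear 'rV[spec_ring iota alpha n]_q -> 'rV[spec_ring iota alpha n]_p} :=
  mulmxr (map_mx spec (lin1_mx phi)).

Definition spec_module : lmodType (spec_ring iota alpha n) := coker spec_hom.

End Specialization.

Arguments spec_ideal {k K} iota {m n} alpha I _.
Arguments spec_hom_def {k K} iota {m n} alpha {p q} phi.
Arguments spec_hom {k K} iota {m n} alpha {p q} phi.
Arguments spec_module {k K} iota {m n} alpha {p q} phi.

Section AlmostAll.
Variables (K : fieldType) (m : nat).

Definition zero_locus (F : {mpoly K[m]} -> Prop) (alpha : 'I_m -> K) : Prop :=
  forall f, F f -> f.@[alpha] = 0.

Definition almost_all (P : ('I_m -> K) -> Prop) : Prop :=
  exists F : {mpoly K[m]} -> Prop,
    (exists beta, ~ zero_locus F beta) /\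
    (forall alpha, ~ zero_locus F alpha -> P alpha).

End AlmostAll.

(* Main.v *)
(* For all alpha outside a hypersurface, the finitely many elements of k(u) in play lie in
   the local ring O of k[u] at the kernel P of evaluation at alpha, and specialization is
   the surjection O[x] -> k(alpha)[x] with kernel P O[x].  A submodule N of R^p has a
   Groebner basis with leading coefficients 1, and division by it only involves the
   coefficients of this basis: it preserves O[x]^p and P O[x]^p.  Hence R^p / N has a
   basis of standard monomials which is compatible with specialization, so that
   nonmembership, preimages under matrices, and thus nonzerodivisors and annihilators
   all specialize.

   If s is a maximal regular sequence on L in I, prime avoidance gives z <> 0 in
   L / (s)L with I z = 0.  Both the regularity of s and the existence of z specialize,
   and by Kaplansky's exchange argument they determine the grade as the length of s. *)
Require Import Defs.
From Stdlib Require List.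
From HB Require Import structures.
From mathcomp Require Import all_boot all_order all_algebra.
From mathcomp.classical Require Import boolp.
From mathcomp Require Import mpoly.

Set Implicit Arguments.
Unset Strict Implicit.
Unset Printing Implicit Defensive.

Import Order.TTheory GRing.Theory.
Local Open Scope ring_scope.

(** * Submodules and weakly regular sequences *)

Section Submodules.
Variables (S : comNzRingType) (V : lmodType S).
Implicit Types (N : V -> Prop) (I : S -> Prop).

(** The claims at [alpha] concern infinitely many objects (all regular sequences, all elements of
    the specialized ideal, all vectors), while only finitely many denominators can be avoided. Hence
    bases and their lifts are chosen before [alpha], and division is stated uniformly in a pair O,
    J. Taking J = O gives integral solutions to equations solvable over R; taking J = P corrects
    lifts that satisfy an equation only modulo P. For the same reason the grade is pinned down by
    finite data: s bounds it from below, the vector z from above, and a vector outside N + IV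
    excludes the infinite value.

    No tower of quotients is formed: L / (s)L is represented by the submodule N + sV of the fixed
    free module V, so specialization of submodules of R^p covers all stages. Statement (ii) is the
    case V = R, N = 0 of the same grade lemma, applied to Ann L, once annihilators are known to
    specialize. Infinitude of k supplies the point off the hypersurface that makes it a proper
    subvariety. *)

Definition submodule N : Prop :=
  [/\ N 0, forall u v, N u -> N v -> N (u + v) & forall a v, N v -> N (a *: v)].

Lemma submoduleB N u v : submodule N -> N u -> N v -> N (u - v).
Proof. by move=> [_ ND NZ] Nu Nv; rewrite -scaleN1r; apply: ND => //; apply: NZ. Qed.

Lemma submodule_sum N (T : Type) (r : seq T) (P : pred T) (F : T -> V) :
  submodule N -> (forall i, P i -> N (F i)) -> N (\sum_(i <- r | P i) F i).
Proof. by move=> [N0 ND _]; apply: big_ind. Qed.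

(** Encoded as an intersection of submodules: a property of the whole span follows from exhibiting
    one submodule, without handling linear combinations. *)
Definition span (s : seq V) v : Prop :=
  forall N, submodule N -> (forall z, z \in s -> N z) -> N v.

Lemma submodule_span s : submodule (span s).
Proof.
split=> [N [] //|u v su sv N subN sN|a v sv N subN sN]; have [_ ND NZ] := subN.
  by apply: ND; [apply: su|apply: sv].
by apply: NZ; apply: sv.
Qed.

Lemma mem_span s z : z \in s -> span s z.
Proof. by move=> sz N _; apply. Qed.

Definition noetherian : Prop := forall N, submodule N ->
  exists s : seq V, (forall z, z \in s -> N z) /\ forall v, N v -> span s v.

Lemma noetherian_acc (N : nat -> V -> Prop) : noetherian ->
    (forall i, submodule (N i)) -> (forall i v, N i v -> N i.+1 v) ->
  exists i, forall v, N i.+1 v -> N i v.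
Proof.
move=> noethV subN incN.
have leN i j v : (i <= j)%N -> N i v -> N j v.
  by move=> /subnK<-; elim: (j - i)%N => // d IH /IH; rewrite addSn; apply: incN.
have subU : submodule (fun v => exists i, N i v).
  split=> [|u v [i Nu] [j Nv]|a v [i Nv]].
  - by exists 0%N; case: (subN 0%N).
  - exists (maxn i j); have [_ ND _] := subN (maxn i j).
    by apply: ND; [apply: leN Nu; rewrite leq_maxl|apply: leN Nv; rewrite leq_maxr].
  - by exists i; have [_ _ NZ] := subN i; apply: NZ.
have [s [sU Us]] := noethV _ subU.
suff [i Ni] : exists i, forall z, z \in s -> N i z.
  by exists i => v Nv; apply: (Us v) => //; exists i.+1.
elim: s sU {Us} => [|z s IH] sU; first by exists 0%N.
have [|i Ni] := IH; first by move=> y sy; apply: sU; rewrite inE sy orbT.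
have [j Nj] := sU z (mem_head z s); exists (maxn i j) => y.
rewrite inE => /orP[/eqP->|/Ni]; first by apply: leN Nj; rewrite leq_maxr.
by apply: leN; rewrite leq_maxl.
Qed.

(** The index [t] is kept apart from the submodule [A t], so that one principle serves annihilators
    of vectors, spans of lists and N + sV for sequences s. Without a maximal index, choice builds a
    strictly increasing chain. *)
Lemma noetherian_max (T : Type) (D : T -> Prop) (A : T -> V -> Prop) (t0 : T) :
    noetherian -> (forall t, D t -> submodule (A t)) -> D t0 ->
  exists t, [/\ D t, forall v, A t0 v -> A t v &
    forall t', D t' -> (forall v, A t v -> A t' v) -> forall v, A t' v -> A t v].
Proof.
move=> noethV subA D0; apply: contrapT => nomax.
pose U := {t | D t /\ forall v, A t0 v -> A t v}.
have next (t : U) : exists t' : U, (forall v, A (sval t) v -> A (sval t') v) /\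
    ~ (forall v, A (sval t') v -> A (sval t) v).
  case: t => t [Dt At] /=; apply: contrapT => nonext; apply: nomax.
  exists t; split=> // t' Dt' tt'; apply: contrapT => Nt't; apply: nonext.
  by exists (exist _ t' (conj Dt' (fun v Av => tt' v (At v Av)))).
have [f fP] := choice next.
pose c i := iter i f (exist _ t0 (conj D0 (fun v Av => Av)) : U).
have [||i ci] := noetherian_acc (N := fun i => A (sval (c i))) noethV.
- by move=> i; apply: subA; case: (c i) => t [].
- by move=> i v; apply: (fP (c i)).1.
by case: (fP (c i)).2.
Qed.

Definition add_mul (a : S) N v : Prop := exists w, N (v - a *: w).

Lemma add_mul_sub a N v : N v -> add_mul a N v.
Proof. by move=> Nv; exists 0; rewrite scaler0 subr0. Qed.

Lemma add_mul_mul a N v : submodule N -> add_mul a N (a *: v).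
Proof. by move=> [N0 _ _]; exists v; rewrite subrr. Qed.

Lemma submodule_add_mul a N : submodule N -> submodule (add_mul a N).
Proof.
move=> subN; have [N0 ND NZ] := subN.
split=> [|u v [x Nx] [y Ny]|b v [x Nx]]; first exact: add_mul_sub.
  by exists (x + y); rewrite scalerDr opprD addrACA; apply: ND.
by exists (b *: x); rewrite scalerA mulrC -scalerA -scalerBr; apply: NZ.
Qed.

Lemma add_mulC a b N : add_mul a (add_mul b N) = add_mul b (add_mul a N).
Proof.
by apply: funext => v; apply: propext;
  split=> -[x [y Nxy]]; exists y; exists x; rewrite addrAC.
Qed.

Definition nonzerodivisor (a : S) N : Prop := forall v, N (a *: v) -> N v.

Fixpoint weakly_regular N (s : seq S) : Prop :=
  if s is a :: s' then nonzerodivisor a N /\ weakly_regular (add_mul a N) s'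
  else True.

Definition add_muls N (s : seq S) : V -> Prop := foldl (fun N a => add_mul a N) N s.

Lemma submodule_add_muls N s : submodule N -> submodule (add_muls N s).
Proof. by elim: s N => //= a s IH N subN; apply: IH; apply: submodule_add_mul. Qed.

Lemma add_muls_sub N s v : N v -> add_muls N s v.
Proof. by elim: s N => //= a s IH N Nv; apply: IH; apply: add_mul_sub. Qed.

Lemma weakly_regular_rcons N s a : weakly_regular N (rcons s a) <->
  weakly_regular N s /\ nonzerodivisor a (add_muls N s).
Proof.
elim: s N => [|b s IH] N /=; first by split=> [[]|[]].
by split=> [[nzb /IH[]]|[[nzb wrs] nza]]; do ?split=> //; apply/IH.
Qed.

Lemma add_muls_rcons N s a : add_muls N (rcons s a) = add_mul a (add_muls N s).
Proof. by rewrite /add_muls foldl_rcons. Qed.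

(** Says Hom(S/I, V/N) is nonzero. A single vector thus certifies that I contains no nonzerodivisor
    on V/N, and one vector can be specialized. *)
Definition has_socle I N : Prop := exists2 v, ~ N v & forall a, I a -> N (a *: v).

Fixpoint depth_geq I N (e : nat) : Prop :=
  if e is e'.+1 then
    exists a, [/\ I a, nonzerodivisor a N & depth_geq I (add_mul a N) e']
  else True.

Lemma weakly_regular_depth_geq I N s : (forall a, a \in s -> I a) ->
  weakly_regular N s -> depth_geq I N (size s).
Proof.
elim: s N => //= a s IH N sI [nza wrs]; exists a; split=> //.
  by apply: sI; rewrite mem_head.
by apply: IH => // b sb; apply: sI; rewrite inE sb orbT.
Qed.

(** If a v = c w modulo N, then c kills w modulo N + aV, so w = a y modulo N; cancelling a leaves v
    = c y. *)
Lemma nonzerodivisor_swap a c N : submodule N -> nonzerodivisor a N ->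
  nonzerodivisor c N -> nonzerodivisor c (add_mul a N) ->
  nonzerodivisor a (add_mul c N).
Proof.
move=> subN nza nzc nzca v [w Nw].
have [y Ny] : add_mul a N w.
  apply: nzca; exists v; rewrite -opprB -scaleN1r.
  by have [_ _] := subN; apply.
exists y; apply: nza.
have [_ ND NZ] := subN.
suff -> : a *: (v - c *: y) = (a *: v - c *: w) + c *: (w - a *: y).
  by apply: ND => //; apply: NZ.
by rewrite !scalerBr addrA subrK !scalerA mulrC.
Qed.

End Submodules.

(** * Associated primes, prime avoidance and exchange of nonzerodivisors *)

Section AssociatedPrimes.
Variables (S : comNzRingType) (V : lmodType S).
Hypothesis noethS : noetherian S^o.
Hypothesis noethV : noetherian V.
Implicit Types (N : V -> Prop) (I : S -> Prop).

Definition prime_pred (P : S -> Prop) : Prop := forall a b, P (a * b) -> P a \/ P b.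

(** The ideals (N : z) obtained in this way are the maximal associated primes of V/N; their union is
    already the set of all zerodivisors. *)
Definition maximal_annihilator N z : Prop := ~ N z /\
  forall v, ~ N v -> (forall a, N (a *: z) -> N (a *: v)) ->
    forall a, N (a *: v) -> N (a *: z).

Lemma submodule_colon N z : submodule N -> submodule (fun a : S^o => N ((a : S) *: z)).
Proof.
move=> [N0 ND NZ]; split=> [|a b Na Nb|a b Nb]; first by rewrite scale0r.
  by rewrite scalerDl; apply: ND.
by rewrite -scalerA; apply: NZ.
Qed.

(** If b z is outside N, its annihilator contains that of z, hence equals it by maximality; so a
    killing b z also kills z. *)
Lemma maximal_annihilator_prime N z : submodule N -> maximal_annihilator N z ->
  prime_pred (fun a => N (a *: z)).
Proof.
move=> [_ _ NZ] [Nz zmax] a b Nabz; have [|nNbz] := pselect (N (b *: z)); first by right.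
left; apply: (zmax (b *: z)) => // [c Ncz|].
  by rewrite scalerA mulrC -scalerA; apply: NZ.
by rewrite scalerA.
Qed.

Lemma maximal_annihilator_above N v : submodule N -> ~ N v ->
  exists2 z, maximal_annihilator N z & forall a, N (a *: v) -> N (a *: z).
Proof.
move=> subN Nv.
have [||z [Nz vz zmax]] := noetherian_max
    (D := fun z => ~ N z) (A := fun z (a : S^o) => N ((a : S) *: z)) (t0 := v) noethS.
- by move=> z _; apply: submodule_colon.
- by [].
by exists z => //; split=> // w Nw zw a; apply: zmax.
Qed.

(** Finiteness comes from the Noetherian property of V: a list of such vectors with maximal span
    already contains all others in its span. *)
Lemma finite_maximal_annihilators N : submodule N -> exists s : seq V,
  (forall z, z \in s -> maximal_annihilator N z) /\
  forall v, ~ N v -> exists2 z, z \in s & forall a, N (a *: v) -> N (a *: z).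
Proof.
move=> subN; have [N0 ND NZ] := subN.
have [|//|s [smax _ s_span]] := noetherian_max
    (D := fun s : seq V => forall z, z \in s -> maximal_annihilator N z)
    (A := @span S V) (t0 := [::]) noethV.
  by move=> s _; apply: submodule_span.
exists s; split=> // v Nv.
have [y ymax vy] := maximal_annihilator_above subN Nv.
have sy : span s y.
  apply: (s_span (y :: s)); last by apply: mem_span; rewrite mem_head.
    by move=> z; rewrite inE => /orP[/eqP->|/smax].
  by move=> u su M subM Mys; apply: su => // z sz; apply: Mys; rewrite inE sz orbT.
suff [z sz yz] : exists2 z, z \in s & forall a, N (a *: y) -> N (a *: z).
  by exists z => // a /vy/yz.
suff [z sz zy] : exists2 z, z \in s & forall a, N (a *: z) -> N (a *: y).
  by exists z => //; apply: (smax z sz).2 => //; case: ymax.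
apply: contrapT => nos.
(* If no (N : z) lies in the prime (N : y), pick in each an element outside (N : y). Their product
   kills [s] modulo N but not y, although y is in the span of [s]. *)
have [b bs Nby] : exists2 b, (forall z, z \in s -> N (b *: z)) & ~ N (b *: y).
  have yprime := maximal_annihilator_prime subN ymax.
  elim: s nos {smax s_span sy} => [|z s IH] nos.
    by exists 1 => //; rewrite scale1r; case: ymax.
  have [|b bs Nby] := IH.
    by case=> x sx xy; apply: nos; exists x => //; rewrite inE sx orbT.
  have [c Ncz Ncy] : exists2 c, N (c *: z) & ~ N (c *: y).
    apply: contrapT => noc; apply: nos; exists z; first by rewrite mem_head.
    by move=> a Naz; apply: contrapT => Nay; apply: noc; exists a.
  exists (c * b) => [x|/yprime[]//].
  rewrite inE => /orP[/eqP->|/bs Nbx]; first by rewrite mulrC -scalerA; apply: NZ.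
  by rewrite -scalerA; apply: NZ.
apply: Nby; apply: (sy (fun v => N (b *: v))) => //.
split=> [|u w Nu Nw|a u Nu]; first by rewrite scaler0.
  by rewrite scalerDr; apply: ND.
by rewrite scalerA mulrC -scalerA; apply: NZ.
Qed.

(** Membership is [List.In] because the indices will be pairs of a predicate and a vector, without
    decidable equality. *)
Lemma prime_avoidance I (T : Type) (P : T -> S -> Prop) (s : seq T) : is_ideal I ->
  (forall t, List.In t s -> is_ideal (P t) /\ prime_pred (P t)) ->
  (forall t, List.In t s -> exists2 a, I a & ~ P t a) ->
  exists2 c, I c & forall t, List.In t s -> ~ P t c.
Proof.
move=> [I0 ID IM]; elim: s => [|t s IH] sP sI; first by exists 0.
have [u su|u su|c Ic cs] := IH.
- by apply: sP; right.
- by apply: sI; right.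
have [tc|ntc] := pselect (P t c); last first.
  by exists c => // u [<-|/cs].
have [[t0 tD tM] tprime] := sP t (or_introl erefl).
(* The correction y must leave [P t] without spoiling the other primes: it lies in each [P u] not
   contained in [P t], and those contained in [P t] are avoided by c + y automatically. This makes
   it unnecessary to discard comparable primes beforehand. *)
have [y Iy [nty ys]] : exists2 y, I y & ~ P t y /\
    forall u, List.In u s -> (forall a, P u a -> P t a) \/ P u y.
  have [y Iy nty] := sI t (or_introl erefl).
  have : forall u, List.In u s -> is_ideal (P u).
    by move=> u su; case: (sP u) => //; right.
  elim: s {IH sP sI cs} => [|u s IH] su; first by exists y.
  have [|x Ix [ntx xs]] := IH; first by move=> v sv; apply: su; right.
  have [ut|nut] := pselect (forall a, P u a -> P t a).
    by exists x => //; split=> // v [<-|/xs//]; left.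
  have [a ua nta] : exists2 a, P u a & ~ P t a.
    apply: contrapT => noa; apply: nut => a ua; apply: contrapT => nta.
    by apply: noa; exists a.
  exists (x * a); first by rewrite mulrC; apply: IM.
  split=> [/tprime[]//|v [<-|sv]].
    by right; have [_ _ uM] := su u (or_introl erefl); apply: uM.
  have [vt|vx] := xs v sv; [by left|right].
  by have [_ _ vM] := su v (or_intror sv); rewrite mulrC; apply: vM.
exists (c + y) => [|u]; first exact: ID.
have ncy : ~ P t (c + y).
  move=> tcy; apply: nty; rewrite -[y](addKr c); apply: tD => //.
  by rewrite -mulN1r; apply: tM.
case=> [<-//|su ucy]; have [ut|uy] := ys u su; first exact: ncy (ut _ ucy).
apply: (cs u su); rewrite -[c](addrK y).
have [[_ uD uM] _] := sP u (or_intror su).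
by apply: uD => //; rewrite -mulN1r; apply: uM.
Qed.

(** Avoidance is applied to the maximal associated primes of all the quotients V/N at once: the
    exchange argument needs one c that works for several N. *)
Lemma exists_nonzerodivisor I (Ns : seq (V -> Prop)) : is_ideal I ->
  (forall N, List.In N Ns -> submodule N /\ ~ has_socle I N) ->
  exists2 c, I c & forall N, List.In N Ns -> nonzerodivisor c N.
Proof.
move=> idI NsP.
have [s [sP sN]] : exists s : seq ((V -> Prop) * V),
    (forall t, List.In t s ->
      [/\ submodule t.1, maximal_annihilator t.1 t.2 & ~ has_socle I t.1]) /\
    forall N v, List.In N Ns -> ~ N v -> exists2 t, List.In t s &
      forall a, N (a *: v) -> t.1 (a *: t.2).
  elim: Ns NsP => [|N Ns IH] NsP; first by exists [::].
  have [|s [sP sN]] := IH; first by move=> M MNs; apply: NsP; right.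
  have [subN socN] := NsP N (or_introl erefl).
  have [r [rP rN]] := finite_maximal_annihilators subN.
  exists ([seq (N, z) | z <- r] ++ s); split=> [t|M v].
    move=> /(List.in_app_or _ _ _)[|/sP//] /List.in_map_iff[z [<- rz]].
    split=> //=; apply: rP; elim: r rz {rN} => //= x r IHr [->|/IHr].
      by rewrite mem_head.
    by rewrite inE => ->; rewrite orbT.
  case=> [<- /rN[z rz vz]|/sN sM /sM[t st vt]]; last first.
    by exists t => //; apply: List.in_or_app; right.
  exists (N, z) => //; apply: List.in_or_app; left; apply: List.in_map.
  elim: r rz {rN rP} => //= x r IHr; rewrite inE => /orP[/eqP->|/IHr]; first by left.
  by right.
have [t st|t st|c Ic cs] :=
    prime_avoidance (P := fun (t : (V -> Prop) * V) a => t.1 (a *: t.2)) (s := s) idI.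
- have [subt tmax _] := sP t st.
  by split; [apply: submodule_colon|apply: maximal_annihilator_prime].
- have [subt [ntt _] soct] := sP t st.
  apply: contrapT => noa; apply: soct; exists t.2 => // a Ia.
  by apply: contrapT => nta; apply: noa; exists a.
exists c => // N NNs v Ncv; apply: contrapT => nNv.
by have [t st vt] := sN N v NNs nNv; apply: (cs t st); apply: vt.
Qed.

(** Both Hom(S/I, V/(N + aV)) and Hom(S/I, V/(N + bV)) are Ext^1(S/I, V/N). Explicitly, z goes to
    the w with b z = a w modulo N. *)
Lemma has_socle_swap I N a b : submodule N -> I a -> I b ->
  nonzerodivisor a N -> nonzerodivisor b N ->
  has_socle I (add_mul a N) -> has_socle I (add_mul b N).
Proof.
move=> subN Ia Ib nza nzb [z nz Iz]; have [w Nw] := Iz b Ib.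
have [_ ND NZ] := subN.
exists w => [[y Ny]|c Ic].
  apply: nz; exists y; apply: nzb.
  suff -> : b *: (z - a *: y) = (b *: z - a *: w) + a *: (w - b *: y).
    by apply: ND => //; apply: NZ.
  by rewrite !scalerBr addrA subrK !scalerA mulrC.
have [x Nx] := Iz c Ic; exists x; apply: nza.
suff -> : a *: (c *: w - b *: x) = b *: (c *: z - a *: x) - c *: (b *: z - a *: w).
  by apply: submoduleB => //; apply: NZ.
rewrite !scalerBr !scalerA opprB [b * c]mulrC [a * c]mulrC [b * a]mulrC.
by rewrite [RHS]addrC addrA subrK.
Qed.

(* Kaplansky's exchange argument: pick c in I that is a nonzerodivisor modulo N,
   N + aV and N + bV, where b starts a long sequence; then b, c, a can be
   permuted freely, and the induction hypothesis is applied at N + bV and N + cV. *)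
Lemma depth_geq_add_mul I e N a : is_ideal I -> submodule N -> I a ->
  nonzerodivisor a N -> depth_geq I N e.+1 -> depth_geq I (add_mul a N) e.
Proof.
move=> idI; elim: e N a => // e IH N a subN Ia nza [b [Ib nzb [c0 [Ic0 nzc0 Ge]]]].
have nosoc (M : V -> Prop) d : I d -> nonzerodivisor d M -> ~ has_socle I M.
  by move=> Id nzd [v nMv IMv]; apply: nMv; apply: nzd; apply: IMv.
have nosocb := nosoc _ _ Ic0 nzc0.
have [M|c Ic cP] := exists_nonzerodivisor
    (Ns := [:: N; add_mul a N; add_mul b N]) idI.
  case=> [<-|[<-|[<-|//]]]; (split; first by do ?exact: submodule_add_mul).
  - exact: nosoc nza.
  (* A socle vector modulo N + aV would give one modulo N + bV, where [c0] in I is a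
     nonzerodivisor. *)
  - by move=> /(has_socle_swap subN Ia Ib nza nzb).
  - exact: nosocb.
have nzc : nonzerodivisor c N by apply: cP; left.
have nzca : nonzerodivisor c (add_mul a N) by apply: cP; right; left.
have nzcb : nonzerodivisor c (add_mul b N) by apply: cP; right; right; left.
have subM d := submodule_add_mul d subN.
exists c; split=> //; rewrite add_mulC; apply: (IH (add_mul c N)) => //.
  exact: nonzerodivisor_swap.
exists b; split=> //; first exact: nonzerodivisor_swap.
rewrite add_mulC; apply: (IH (add_mul b N)) => //.
by exists c0; split.
Qed.

(** Each element of [s] lowers the available depth by at most one, by exchange; when [s] is
    exhausted, the socle vector leaves no nonzerodivisor in I. *)
Lemma depth_geq_socle I N s e : is_ideal I -> submodule N ->
  (forall a, a \in s -> I a) -> weakly_regular N s -> has_socle I (add_muls N s) ->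
  depth_geq I N e -> (e <= size s)%N.
Proof.
move=> idI; elim: s N e => [|a s IH] N [|e] //= subN sI.
  by move=> _ [v nv Iv] [a [Ia nza _]]; case: nv; apply: nza; apply: Iv.
move=> [nza wrs] socs Ge; apply: (IH (add_mul a N)) => //.
- exact: submodule_add_mul.
- by move=> b sb; apply: sI; rewrite inE sb orbT.
- by apply: depth_geq_add_mul => //; apply: sI; rewrite mem_head.
Qed.

(** M stands for N + IV. Maximality is imposed on the submodule N + sV, not on the length of s,
    whose boundedness is not yet known. *)
Lemma exists_regular_socle I N M : is_ideal I -> submodule N -> submodule M ->
  (forall v, N v -> M v) -> (forall a v, I a -> M (a *: v)) -> (exists v, ~ M v) ->
  exists s, [/\ forall a, a \in s -> I a, weakly_regular N s &
    has_socle I (add_muls N s)].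
Proof.
move=> idI subN subM NM IM [v0 nMv0].
have [|//|s [[sI wrs] _ smax]] := noetherian_max
  (D := fun s => (forall a, a \in s -> I a) /\ weakly_regular N s)
  (A := add_muls N) (t0 := [::]) noethV.
  by move=> s _; apply: submodule_add_muls.
exists s; split=> //; apply: contrapT => nosoc.
have subs := submodule_add_muls s subN.
have [L|c Ic cs] := exists_nonzerodivisor (Ns := [:: add_muls N s]) idI.
  by case=> // <-.
have nzc : nonzerodivisor c (add_muls N s) by apply: cs; left.
apply: nMv0; suff sM v : add_muls N s v -> M v.
  (* By maximality, appending c does not enlarge N + sV, so c V lies in it; cancelling c puts all of
     V there, hence in M. *)
  apply: sM; apply: (nzc); apply: (smax (rcons s c)).
  - split=> [a|]; last by apply/weakly_regular_rcons.
    by rewrite mem_rcons inE => /orP[/eqP->|/sI].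
  - by move=> v; rewrite add_muls_rcons; apply: add_mul_sub.
  - by rewrite add_muls_rcons; apply: add_mul_mul.
elim: s N subN NM {smax wrs nosoc subs cs nzc} sI v => [|a s IH] N subN NM sI; first exact: NM.
apply: IH => [|v [w Nw]|b sb].
- exact: submodule_add_mul.
- rewrite -[v](subrK (a *: w)); have [_ MD _] := subM; apply: MD; first exact: NM.
  by apply: IM; apply: sI; rewrite mem_head.
- by apply: sI; rewrite inE sb orbT.
Qed.

End AssociatedPrimes.

(** * The grade of L computed in V, for a surjection V -> L with kernel N *)

Section GradeQuotient.
Variable S : comNzRingType.
Implicit Types (I : S -> Prop) (s : seq S).

Lemma submodule_ideal_mul I (L : lmodType S) : submodule (@ideal_mul S I L).
Proof.
split=> [|u v [r1 [a1 [w1 [aI1 ->]]]] [r2 [a2 [w2 [aI2 ->]]]]|b v [r [a [w [aI ->]]]]].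
- by exists 0%N, (fun=> 0), (fun=> 0); split=> [[]//|]; rewrite big_ord0.
- exists (r1 + r2)%N, (fun i => match split i with inl j => a1 j | inr j => a2 j end),
    (fun i => match split i with inl j => w1 j | inr j => w2 j end).
  split=> [i|]; first by case: (split i).
  rewrite big_split_ord /=; congr (_ + _); apply: eq_bigr => i _.
    by rewrite -[lshift _ _]/(unsplit (inl i)) unsplitK.
  by rewrite -[rshift _ _]/(unsplit (inr i)) unsplitK.
- exists r, a, (fun i => b *: w i); split=> //.
  by rewrite scaler_sumr; apply: eq_bigr => i _; rewrite !scalerA mulrC.
Qed.

Lemma ideal_mul_scale I (L : lmodType S) a (v : L) : I a -> ideal_mul I (a *: v).
Proof. by move=> Ia; exists 1%N, (fun=> a), (fun=> v); rewrite big_ord1. Qed.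

Lemma ideal_mulS I I' (L : lmodType S) (v : L) :
  (forall a, I a -> I' a) -> ideal_mul I v -> ideal_mul I' v.
Proof. by move=> II' [r [a [w [aI ->]]]]; exists r, a, w; split=> // i; apply: II'. Qed.

Lemma seq_mulP (L : lmodType S) s (v : L) :
  seq_mul s v <-> add_muls (fun u : L => u = 0) s v.
Proof.
have sub0 : submodule (fun u : L => u = 0).
  by split=> [//|u w -> ->|a u ->]; rewrite ?addr0 ?scaler0.
have mem_add_muls (N : L -> Prop) (t : seq S) g w :
    submodule N -> g \in t -> add_muls N t (g *: w).
  elim: t N => //= b t IH N subN; rewrite inE => /orP[/eqP->|gt].
    by apply: add_muls_sub; apply: add_mul_mul.
  by apply: IH => //; apply: submodule_add_mul.
split=> [[r [a [w [aI ->]]]]|].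
  have subs := submodule_add_muls s sub0.
  apply: submodule_sum => // i _; have [r' [c [g [gs ->]]]] := aI i.
  rewrite scaler_suml; apply: submodule_sum => // j _; rewrite -scalerA.
  by have [_ _ sZ] := subs; apply: sZ; apply: mem_add_muls.
suff add_seq (N : L -> Prop) (t : seq S) u : add_muls N t u ->
    exists2 w, seq_mul t w & N (u - w).
  by move=> /add_seq[w sw /eqP]; rewrite subr_eq0 => /eqP->.
elim: t N u => [|a t IH] N u /=.
  move=> Nu; exists 0; rewrite ?subr0 //.
  by have [] := submodule_ideal_mul (ideal_gen (fun x => x \in [::])) L.
move=> /IH[w sw [x Nx]]; exists (w + a *: x); last by rewrite opprD addrA.
have [_ mD _] := submodule_ideal_mul (ideal_gen (fun x => x \in a :: t)) L.
apply: mD.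
  apply: ideal_mulS sw => b [r [c [g [gt ->]]]]; exists r, c, g; split=> // i.
  by rewrite inE gt orbT.
apply: ideal_mul_scale; exists 1%N, (fun=> 1), (fun=> a); split=> [_|].
  by rewrite mem_head.
by rewrite big_ord1 mul1r.
Qed.

Lemma weakly_regular_take (L : lmodType S) (N : L -> Prop) s : weakly_regular N s <->
  forall i, (i < size s)%N -> nonzerodivisor s`_i (add_muls N (take i s)).
Proof.
elim: s N => [|a s IH] N //=; split=> [[nza /IH wrs] [|i] //|nzs]; first exact: wrs.
by split; [apply: (nzs 0%N)|apply/IH => i; apply: (nzs i.+1)].
Qed.

Lemma regular_seqP (L : lmodType S) s : regular_seq L s <->
  ~ (forall v : L, add_muls (fun u => u = 0) s v) /\
  weakly_regular (fun u : L => u = 0) s.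
Proof.
split=> -[nall nz]; split.
- by move=> all; apply: nall => v; apply/seq_mulP.
- by apply/weakly_regular_take => i si v /seq_mulP/(nz i si)/seq_mulP.
- by move=> all; apply: nall => v; apply/seq_mulP.
- move/weakly_regular_take: nz => nz i si v /seq_mulP siv; apply/seq_mulP.
  exact: nz.
Qed.

Variables (V L : lmodType S) (pi : {linear V -> L}) (N : V -> Prop).
Hypothesis pi_surj : forall y, exists v, pi v = y.
Hypothesis pi_ker : forall v, pi v = 0 <-> N v.

Lemma submodule_ker : submodule N.
Proof.
split=> [|u v /pi_ker u0 /pi_ker v0|a v /pi_ker v0]; apply/pi_ker.
- exact: linear0.
- by rewrite linearD u0 v0 addr0.
- by rewrite linearZ /= v0 scaler0.
Qed.

Lemma add_mul_preim (M : V -> Prop) (M' : L -> Prop) a :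
  (forall v, M' (pi v) <-> M v) -> forall v, add_mul a M' (pi v) <-> add_mul a M v.
Proof.
move=> MM' v; split=> [[y]|[w Mw]]; last by exists (pi w); rewrite -linearZ -linearB; apply/MM'.
by have [w <-] := pi_surj y; rewrite -linearZ -linearB => /MM' Mw; exists w.
Qed.

Lemma add_muls_preim (M : V -> Prop) (M' : L -> Prop) s :
  (forall v, M' (pi v) <-> M v) -> forall v, add_muls M' s (pi v) <-> add_muls M s v.
Proof.
by elim: s M M' => //= a s IH M M' MM'; apply: IH; apply: add_mul_preim.
Qed.

Lemma weakly_regular_preim (M : V -> Prop) (M' : L -> Prop) s :
  (forall v, M' (pi v) <-> M v) -> weakly_regular M' s <-> weakly_regular M s.
Proof.
elim: s M M' => //= a s IH M M' MM'.
have {}IH := IH _ _ (add_mul_preim a MM').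
split=> -[nz /IH wrs]; split=> //.
  by move=> v Mav; apply/MM'; apply: nz; rewrite -linearZ; apply/MM'.
move=> y; have [v <-] := pi_surj y; rewrite -linearZ => /MM' Mav.
by apply/MM'; apply: nz.
Qed.

Definition add_ideal I v : Prop := exists2 u, ideal_mul I u & N (v - u).

Lemma submodule_add_ideal I : submodule (add_ideal I).
Proof.
have [N0 ND NZ] := submodule_ker; have [m0 mD mZ] := submodule_ideal_mul I V.
split=> [|u v [x mx Nx] [y my Ny]|a v [x mx Nx]].
- by exists 0; rewrite ?subr0.
- by exists (x + y); [apply: mD|rewrite opprD addrACA; apply: ND].
- by exists (a *: x); [apply: mZ|rewrite -scalerBr; apply: NZ].
Qed.

Lemma ideal_mul_preim I v : ideal_mul I (pi v) <-> add_ideal I v.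
Proof.
split=> [[r [a [y [aI yE]]]]|[u [r [a [w [aI ->]]]] Nu]].
  have [w wy] := choice (fun i => pi_surj (y i)).
  exists (\sum_i a i *: w i); first by exists r, a, w.
  apply/pi_ker; rewrite linearB yE linear_sum; apply/eqP; rewrite subr_eq0; apply/eqP.
  by apply: eq_bigr => i _; rewrite linearZ wy.
exists r, a, (fun i => pi (w i)); split=> //.
move/pi_ker: Nu; rewrite linearB => /eqP; rewrite subr_eq0 => /eqP->.
by rewrite linear_sum; apply: eq_bigr => i _; rewrite linearZ.
Qed.

Lemma grade_None I : (forall v, add_ideal I v) -> grade I L = None.
Proof.
move=> all; rewrite /grade; case: pselect => // -[] y.
by have [v <-] := pi_surj y; apply/ideal_mul_preim.
Qed.

Hypothesis noethS : noetherian S^o.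
Hypothesis noethV : noetherian V.

(** The criterion used on both sides of the specialization: a weakly regular sequence followed by a
    socle vector determines the grade. *)
Lemma grade_Some I s : is_ideal I -> ~ (forall v, add_ideal I v) ->
  (forall a, a \in s -> I a) -> weakly_regular N s -> has_socle I (add_muls N s) ->
  grade I L = Some (size s).
Proof.
move=> idI nall sI wrs socs; rewrite /grade.
case: pselect => [all|_]; first by case: nall => v; apply/ideal_mul_preim.
have preim0 v : (pi v = 0) <-> N v by apply: pi_ker.
have regs : regular_seq_in I L s.
  split=> //; apply/regular_seqP; split; last first.
    by apply/(@weakly_regular_preim N (fun u => u = 0) _ preim0).
  (* The socle vector also shows that (s)L is not L, as regularity demands beyond weak
     regularity. *)
  by case: socs => v nv _ all; apply: nv; apply/(@add_muls_preim N (fun u => u = 0) _ preim0).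
have maxs t : regular_seq_in I L t -> (size t <= size s)%N.
  move=> [tI /regular_seqP[_ /(@weakly_regular_preim N (fun u => u = 0) _ preim0) wrt]].
  apply: (depth_geq_socle noethS noethV idI submodule_ker sI wrs socs).
  exact: weakly_regular_depth_geq.
case: pselect => [h|[]]; last by exists (size s); split=> //; exists s.
case: (cid h) => d dmax /=; congr Some; case: dmax => [[t regt <-] maxt].
by apply/eqP; rewrite eqn_leq maxs // maxt.
Qed.

End GradeQuotient.

(** * Groebner bases *)

(** Each chosen index minimizes [g] on the tail after the previous one, so later values cannot be
    smaller. *)
Lemma nondecreasing_subsequence (g : nat -> nat) : exists f : nat -> nat,
  (forall i j, (i < j)%N -> (f i < f j)%N) /\
  (forall i j, (i <= j)%N -> (g (f i) <= g (f j))%N).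
Proof.
have argmin N : exists i, (N <= i)%N /\ forall j, (N <= j)%N -> (g i <= g j)%N.
  have ex_val : exists v, `[< exists2 i, (N <= i)%N & g i = v >].
    by exists (g N); apply/asboolP; exists N.
  have [v /asboolP[i Ni <-] vmin] := ex_minnP ex_val.
  by exists i; split=> // j Nj; apply: vmin; apply/asboolP; exists j.
have [a aP] := choice argmin.
pose f i := iter i (fun x => a x.+1) (a 0%N).
have fS i : (f i < f i.+1)%N by apply: (aP (f i).+1).1.
have fmono : forall i j, (i < j)%N -> (f i < f j)%N.
  move=> i; elim=> // j IH; rewrite ltnS leq_eqVlt => /orP[/eqP->//|/IH lt_ij].
  exact: ltn_trans lt_ij (fS j).
exists f; split=> // i j; rewrite leq_eqVlt => /orP[/eqP->//|/fmono/ltnW].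
by case: i => [|i] fij; [apply: (aP 0%N).2|apply: (aP (f i).+1).2; apply: leq_trans fij].
Qed.

Lemma nondecreasing_subsequence_mnm n (g : nat -> 'X_{1..n}) : exists f : nat -> nat,
  (forall i j, (i < j)%N -> (f i < f j)%N) /\
  (forall i j, (i <= j)%N -> (g (f i) <= g (f j))%MM).
Proof.
suff [f [fmono fle]] : exists f : nat -> nat,
    (forall i j, (i < j)%N -> (f i < f j)%N) /\
    (forall c : 'I_n, c \in enum 'I_n ->
       forall i j, (i <= j)%N -> (g (f i) c <= g (f j) c)%N).
  by exists f; split=> // i j ij; apply/mnm_lepP => c; apply: fle; rewrite ?mem_enum.
elim: (enum 'I_n) => [|c s [f [fmono fle]]]; first by exists id.
have [h [hmono hle]] := nondecreasing_subsequence (fun i => g (f i) c).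
have hleq i j : (i <= j)%N -> (h i <= h j)%N.
  by rewrite leq_eqVlt => /orP[/eqP->//|/hmono/ltnW].
exists (f \o h); split=> [i j ij|d] /=; first by apply: fmono; apply: hmono.
by rewrite inE => /orP[/eqP->//|sd i j ij]; apply: fle => //; apply: hleq.
Qed.

(** Otherwise choice yields a sequence in which no monomial is divisible by an earlier one, against
    the existence of a nondecreasing subsequence. *)
Lemma dickson n (P : 'X_{1..n} -> Prop) : exists s : seq 'X_{1..n},
  (forall m, m \in s -> P m) /\
  forall m, P m -> exists2 m', m' \in s & (m' <= m)%MM.
Proof.
apply: contrapT => noP.
pose U := {s : seq 'X_{1..n} | forall m, m \in s -> P m}.
have next (s : U) : exists m, P m /\ forall m', m' \in sval s -> ~ (m' <= m)%MM.
  case: s => s sP /=; apply: contrapT => nonext; apply: noP; exists s; split=> // m Pm.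
  apply: contrapT => nom; apply: nonext; exists m; split=> // m' sm' m'm.
  by apply: nom; exists m'.
have [f fP] := choice next.
have consP (s : U) : forall m, m \in f s :: sval s -> P m.
  by move=> m; rewrite inE => /orP[/eqP->|/(svalP s)//]; case: (fP s).
have nilP : forall m : 'X_{1..n}, m \in [::] -> P m by [].
pose c i := iter i (fun s : U => exist _ (f s :: sval s) (consP s) : U)
  (exist _ [::] nilP : U).
have cmem i j : (i < j)%N -> f (c i) \in sval (c j).
  elim: j => // j IH; rewrite ltnS leq_eqVlt => /orP[/eqP->|/IH].
    by rewrite /= mem_head.
  by move=> cj; rewrite /= inE cj orbT.
have [h [hmono hle]] := nondecreasing_subsequence_mnm (fun i => f (c i)).
by apply: (fP (c (h 1%N))).2 (cmem _ _ (hmono 0%N 1%N erefl)) (hle 0%N 1%N erefl).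
Qed.

(** * Division with control of the coefficients *)

Section Division.
Variables (Q : fieldType) (n : nat).
Local Notation R := {mpoly Q[n]}.
Implicit Types (O J : Q -> Prop) (f g : R).

(** Instantiated by a local ring acting on itself and on its maximal ideal; O = J = everything gives
    ordinary division. *)
Definition module_over O J : Prop := [/\ J 0, forall a b, J a -> J b -> J (a - b)
  & forall a b, O a -> J b -> J (a * b)].

Lemma module_overD O J a b : module_over O J -> J a -> J b -> J (a + b).
Proof.
move=> [J0 JB _] Ja Jb; rewrite -[b]opprK; apply: (JB) => //.
by rewrite -sub0r; apply: JB.
Qed.

Definition coef_in J f : Prop := forall m, J f@_m.

Lemma coef_inB O J f g : module_over O J ->
  coef_in J f -> coef_in J g -> coef_in J (f - g).
Proof. by move=> [_ JB _] Jf Jg m; rewrite mcoeffB; apply: JB. Qed.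

Lemma coef_inM O J f g : module_over O J ->
  coef_in O f -> coef_in J g -> coef_in J (f * g).
Proof.
move=> OJ Of Jg m; rewrite mcoeffM; have [J0 JB JM] := OJ.
by apply: big_ind => // [a b|i _]; [apply: (module_overD OJ)|apply: JM].
Qed.

Lemma coef_in0 O J : module_over O J -> coef_in J 0.
Proof. by move=> [J0 _ _] m; rewrite mcoeff0. Qed.

Lemma coef_inD O J f g : module_over O J ->
  coef_in J f -> coef_in J g -> coef_in J (f + g).
Proof. by move=> OJ Jf Jg m; rewrite mcoeffD; apply: (module_overD OJ). Qed.

Lemma coef_inZX O J c m : module_over O J -> J c -> coef_in J (c *: 'X_[m]).
Proof.
move=> [J0 _ _] Jc k; rewrite mcoeffZ mcoeffX.
by case: eqP => _; rewrite ?mulr1 ?mulr0.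
Qed.

Lemma mlead_sub_lt f h : f != 0 -> mlead h = mlead f -> mleadc h = mleadc f ->
  f - h = 0 \/ (mlead (f - h)%R < mlead f)%O.
Proof.
move=> f0 lh lch; have [->|fh0] := eqVneq (f - h) 0; [by left|right].
rewrite lt_neqAle; apply/andP; split.
  apply: contra fh0 => /eqP eql; rewrite -mleadc_eq0 eql mcoeffB.
  by rewrite -lch lh subrr.
by apply: le_trans (mleadB_le _ _) _; rewrite lh joinxx.
Qed.

(* The g j form a Groebner basis of I with leading coefficients 1, and Std is the
   span of the standard monomials; dividing by the g j only uses the
   coefficients of f and of the g j. *)
Lemma division_ideal (I : R -> Prop) : is_ideal I ->
  exists (T : finType) (g : T -> R) (Std : R -> Prop),
  [/\ forall j, I (g j), forall r r', Std r -> Std r' -> Std (r - r'),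
      forall r, Std r -> I r -> r = 0
    & forall O J, module_over O J -> (forall j, coef_in O (g j)) ->
      forall f, coef_in J f -> exists c : T -> R,
        (forall j, coef_in J (c j)) /\ Std (f - \sum_j c j * g j)].
Proof.
move=> [I0 ID IM].
have [s [sP sI]] := dickson (fun m => exists2 f, I f & f != 0 /\ mlead f = m).
have monic (j : 'I_(size s)) : exists g, [/\ I g, mleadc g = 1 & mlead g = nth 0%MM s j].
  have [f If [f0 lf]] := sP (nth 0%MM s j) (mem_nth _ (ltn_ord j)).
  have c0 : mleadc f != 0 by rewrite mleadc_eq0.
  exists ((mleadc f)^-1 *: f); split.
  - by rewrite -mul_mpolyC; apply: IM.
  - by rewrite mleadcZE mulVf.
  - by rewrite mleadZ // invr_eq0.
have [g gP] := choice monic.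
pose Std (r : R) := forall m j, (mlead (g j) <= m)%MM -> r@_m = 0.
exists 'I_(size s), g, Std; split=> [j|r r' Sr Sr' m j gm|r Sr Ir|O J OJ Og].
- by case: (gP j).
- by rewrite mcoeffB (Sr m j) // (Sr' m j) // subrr.
- have [//|r0] := eqVneq r 0.
  have [m ms mr] : exists2 m, m \in s & (m <= mlead r)%MM by apply: sI; exists r.
  have js : (index m s < size s)%N by rewrite index_mem.
  apply/eqP; rewrite -mleadc_eq0; apply/eqP; apply: (Sr _ (Ordinal js)).
  by have [_ _ ->] := gP (Ordinal js); rewrite nth_index.
have J00 : exists c : 'I_(size s) -> R,
    (forall j, coef_in J (c j)) /\ Std (0 - \sum_j c j * g j).
  exists (fun=> 0); split=> [j|]; first exact: (coef_in0 OJ).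
  by rewrite big1 ?subr0 => [m j _|j _]; rewrite ?mcoeff0 ?mul0r.
elim/mleadrect => f IH Jf; have [->//|f0] := eqVneq f 0.
pose lt := mlead f; pose a := mleadc f.
have [[j jf]|nojf] := pselect (exists j, (mlead (g j) <= lt)%MM).
  pose q := a *: 'X_[lt - mlead (g j)].
  have [_ gmon _] := gP j.
  have a0 : a != 0 by rewrite mleadc_eq0.
  have gj0 : g j != 0 by rewrite -mleadc_eq0 gmon oner_eq0.
  have q0 : q != 0 by rewrite -mleadc_eq0 mleadcZE mleadXm mcoeffX eqxx mulr1.
  have Jq : coef_in J q by rewrite /q; apply: (coef_inZX _ OJ); apply: Jf.
  have [c [Jc Sc]] : exists c : 'I_(size s) -> R, (forall j, coef_in J (c j)) /\
      Std (f - q * g j - \sum_j c j * g j).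
    have Jf' : coef_in J (f - q * g j).
      by apply: (coef_inB OJ) => //; rewrite mulrC; apply: (coef_inM OJ).
    have [||->//|lf'] := @mlead_sub_lt f (q * g j) f0; last exact: IH.
      by rewrite mleadM // mleadZ // mleadXm submK.
    by rewrite mleadM // mleadcM gmon mulr1 /q mleadcZE mleadXm mcoeffX eqxx mulr1.
  exists (fun i => c i + (i == j)%:R * q); split=> [i|].
    apply: (coef_inD OJ) => //.
    by case: eqP => _; rewrite ?mul1r ?mul0r //; apply: (coef_in0 OJ).
  suff -> : \sum_i (c i + (i == j)%:R * q) * g i = q * g j + \sum_i c i * g i.
    by rewrite opprD addrA.
  under eq_bigr do rewrite mulrDl; rewrite big_split /= addrC; congr (_ + _).
  rewrite (bigD1 j) //= eqxx mul1r big1 ?addr0 // => i /negPf->.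
  by rewrite !mul0r.
(* The leading term is not reducible, so it is itself standard: it is set aside, the rest is
   divided, and it is added back to the remainder. *)
pose h := a *: 'X_[lt].
have [c [Jc Sc]] : exists c : 'I_(size s) -> R, (forall j, coef_in J (c j)) /\
    Std (f - h - \sum_j c j * g j).
  have a0 : a != 0 by rewrite mleadc_eq0.
  have Jf' : coef_in J (f - h).
    by apply: (coef_inB OJ) => //; rewrite /h; apply: (coef_inZX _ OJ); apply: Jf.
  have [||->//|lf'] := @mlead_sub_lt f h f0; last exact: IH.
    by rewrite mleadZ // mleadXm.
  by rewrite /h mleadcZE mleadXm mcoeffX eqxx mulr1.
exists c; split=> // m j jm; rewrite -[f](subrK h) addrAC mcoeffD (Sc m j) //.
rewrite add0r /h mcoeffZ mcoeffX; case: eqP => [ltm|_]; last by rewrite mulr0.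
by case: nojf; exists j; rewrite ltm.
Qed.

Definition mx_in J (a b : nat) (A : 'M[R]_(a, b)) : Prop :=
  forall i j, coef_in J (A i j).

(* Induction on p: divide the first entry by a basis of the ideal of first entries
   of N, then the others by a basis of the elements of N with first entry 0. *)
Lemma division_module p (N : 'rV[R]_p -> Prop) : submodule N ->
  exists (T : finType) (g : T -> 'rV[R]_p) (Std : 'rV[R]_p -> Prop),
  [/\ forall j, N (g j), forall r r', Std r -> Std r' -> Std (r - r'),
      forall r, Std r -> N r -> r = 0
    & forall O J, module_over O J -> (forall j, mx_in O (g j)) ->
      forall f : 'rV[R]_p, mx_in J f -> exists c : T -> R,
        (forall j, coef_in J (c j)) /\ Std (f - \sum_j c j *: g j)].
Proof.
elim: p N => [N subN|p IH].
  exists void, (fun=> 0), (fun=> True); split=> // [r _ _|O J OJ _ f _].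
    by apply/rowP => -[].
  by exists (fun=> 0); split=> // -[].
rewrite -[p.+1]/(1 + p)%N => N subN; have [N0 ND NZ] := subN.
pose cons (a : R) (w : 'rV[R]_p) : 'rV[R]_(1 + p) := row_mx a%:M w.
pose hd (f : 'rV[R]_(1 + p)) := f 0 (lshift p 0).
pose tl (f : 'rV[R]_(1 + p)) := rsubmx f.
have consK (f : 'rV[R]_(1 + p)) : cons (hd f) (tl f) = f.
  rewrite -[RHS]hsubmxK /cons; congr row_mx.
  by rewrite [RHS]mx11_scalar mxE.
have hdB (f f' : 'rV[R]_(1 + p)) : hd (f - f') = hd f - hd f' by rewrite /hd !mxE.
have tlB (f f' : 'rV[R]_(1 + p)) : tl (f - f') = tl f - tl f' by rewrite /tl raddfB.
have hd_cons a w : hd (cons a w) = a by rewrite /hd row_mxEl mxE eqxx mulr1n.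
have tl_cons a w : tl (cons a w) = w by rewrite /tl row_mxKr.
have consD a b v w : cons (a + b) (v + w) = cons a v + cons b w.
  by rewrite /cons add_row_mx raddfD.
have consZ a b w : cons (a * b) (a *: w) = a *: cons b w.
  by rewrite /cons scale_row_mx scale_scalar_mx.
have cons0 : cons 0 0 = 0 by rewrite /cons raddf0 row_mx0.
have [|T1 [g1 [Std1 [g1I Std1B Std1I div1]]]] :=
    @division_ideal (fun a => exists w, N (cons a w)).
  split=> [|a b [v Nav] [w Nbw]|a b [w Nbw]].
  - by exists 0; rewrite cons0.
  - by exists (v + w); rewrite consD; apply: ND.
  - by exists (a *: w); rewrite consZ; apply: NZ.
have [|T2 [g2 [Std2 [g2N Std2B Std2N div2]]]] := IH (fun w => N (cons 0 w)).
  split=> [|v w Nv Nw|a w Nw].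
  - by rewrite cons0.
  - by rewrite -[0]addr0 consD; apply: ND.
  - by rewrite -[0](mulr0 a) consZ; apply: NZ.
have [w wN] := choice g1I.
pose g (j : T1 + T2) : 'rV[R]_(1 + p) :=
  match j with inl j => cons (g1 j) (w j) | inr j => cons 0 (g2 j) end.
exists (T1 + T2)%type, g, (fun f : 'rV[R]_(1 + p) => Std1 (hd f) /\ Std2 (tl f)).
split=> [[j|j]|r r' [S1 S2] [S1' S2']|r [S1 S2] Nr|O J OJ Og f Jf].
- exact: wN.
- exact: g2N.
- by rewrite hdB tlB; split; [apply: Std1B|apply: Std2B].
- have hd0 : hd r = 0 by apply: Std1I => //; exists (tl r); rewrite consK.
  have tl0 : tl r = 0 by apply: Std2N => //; rewrite -hd0 consK.
  by rewrite -[r]consK hd0 tl0 cons0.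
have Og1 j : coef_in O (g1 j) by rewrite -[g1 j](hd_cons _ (w j)); apply: (Og (inl j)).
have Ow j : mx_in O (w j).
  by move=> i l; have := Og (inl j) i (rshift 1 l); rewrite /g row_mxEr.
have Og2 j : mx_in O (g2 j).
  by move=> i l; have := Og (inr j) i (rshift 1 l); rewrite /g row_mxEr.
have [c1 [Jc1 Sc1]] := div1 O J OJ Og1 (hd f) (Jf _ _).
have [|c2 [Jc2 Sc2]] := div2 O J OJ Og2 (tl f - \sum_j c1 j *: w j).
  move=> i l; rewrite !mxE summxE; apply: (coef_inB OJ); first exact: Jf.
  elim/big_rec: _ => [|j a _ Ja]; first exact: (coef_in0 OJ).
  by rewrite !mxE mulrC; apply: (coef_inD OJ) => //; apply: (coef_inM OJ); [apply: Ow|].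
exists (fun j => match j with inl j => c1 j | inr j => c2 j end).
split=> [[]//|]; rewrite big_sumType /=.
have -> : f - (\sum_j c1 j *: cons (g1 j) (w j) + \sum_j c2 j *: cons 0 (g2 j)) =
    cons (hd f - \sum_j c1 j * g1 j)
         (tl f - \sum_j c1 j *: w j - \sum_j c2 j *: g2 j).
  have sum1 : \sum_j c1 j *: cons (g1 j) (w j) =
      cons (\sum_j c1 j * g1 j) (\sum_j c1 j *: w j).
    elim/big_rec3: _ => [|j a b v _ ->]; first by rewrite cons0.
    by rewrite consD consZ.
  have sum2 : \sum_j c2 j *: cons 0 (g2 j) = cons 0 (\sum_j c2 j *: g2 j).
    elim/big_rec2: _ => [|j a b _ ->]; first by rewrite cons0.
    by rewrite -consZ mulr0 -consD addr0.
  rewrite sum1 sum2 -consD addr0; apply/eqP; rewrite subr_eq -consD subrK.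
  by rewrite -[_ - _ - _]addrA -opprD subrK consK.
by rewrite hd_cons tl_cons.
Qed.

(** The [g t] form a basis of N plus the row space of C, and [w t] solves the problem for [g t].
    Dividing f by the basis leaves remainder 0, and its quotients, which lie in J, combine the [w t]
    into x. *)
Lemma lift_sum p q (C : 'M[R]_(q, p)) (N : 'rV[R]_p -> Prop) : submodule N ->
  exists (T : finType) (g : T -> 'rV[R]_p) (w : T -> 'rV[R]_q),
  forall O J, module_over O J ->
    (forall t, mx_in O (g t)) -> (forall t, mx_in O (w t)) ->
    forall f : 'rV[R]_p, mx_in J f -> (exists x, N (f - x *m C)) ->
    exists2 x, mx_in J x & N (f - x *m C).
Proof.
move=> subN; have [N0 ND NZ] := subN.
have [|T [g [Std [gN _ StdN div]]]] :=
    @division_module p (fun f : 'rV[R]_p => exists x, N (f - x *m C)).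
  split=> [|u v [x Nx] [y Ny]|a v [x Nx]].
  - by exists 0; rewrite mul0mx subrr.
  - by exists (x + y); rewrite mulmxDl opprD addrACA; apply: ND.
  - by exists (a *: x); rewrite -scalemxAl -scalerBr; apply: NZ.
have [w wN] := choice gN.
exists T, g, w => O J OJ Og Ow f Jf [x Nx].
have [c [Jc Sc]] := div _ _ OJ Og f Jf.
exists (\sum_t c t *: w t).
  move=> i j; rewrite summxE; elim/big_rec: _ => [|t a _ Ja]; first exact: (coef_in0 OJ).
  by rewrite mxE mulrC; apply: (coef_inD OJ) => //; apply: (coef_inM OJ); [apply: Ow|].
have /eqP : f - \sum_t c t *: g t = 0.
  apply: StdN Sc _; exists (x - \sum_t c t *: w t).
  suff -> : f - \sum_t c t *: g t - (x - \sum_t c t *: w t) *m C =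
      (f - x *m C) - \sum_t c t *: (g t - w t *m C).
    by apply: submoduleB => //; apply: submodule_sum => // t _; apply: NZ.
  under [in RHS]eq_bigr do rewrite scalerBr scalemxAl.
  rewrite sumrB -mulmx_suml mulmxBl !opprB.
  by rewrite [X in _ + X = _]addrC addrACA [X in _ + X = _]addrC.
rewrite subr_eq0 => /eqP->; rewrite mulmx_suml -sumrB; apply: submodule_sum => // t _.
by rewrite -scalemxAl -scalerBr; apply: NZ.
Qed.

(** [r] is the normal form of v, hence also that of v - u for every u in N; so if v is congruent to
    an element of N modulo J, the entries of [r] have coefficients in J. *)
Lemma nonzero_remainder p (N : 'rV[R]_p -> Prop) v : submodule N -> ~ N v ->
  exists (T : finType) (g : T -> 'rV[R]_p) (r : 'rV[R]_p), r != 0 /\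
  forall O J, module_over O J -> (forall t, mx_in O (g t)) ->
    forall u, N u -> mx_in J (v - u) -> mx_in J r.
Proof.
move=> subN nNv; have [N0 ND NZ] := subN.
have [T [g [Std [gN StdB StdN div]]]] := division_module subN.
have NgZ (c : T -> R) : N (\sum_j c j *: g j).
  by apply: submodule_sum => // j _; apply: NZ.
have [|||c [_ Sc]] := div (fun=> True) (fun=> True) _ _ v; do 1?[by []].
exists T, g, (v - \sum_j c j *: g j); split.
  by apply: contra_notN nNv; rewrite subr_eq0 => /eqP->; apply: NgZ.
move=> O J OJ Og u Nu Jvu; have [c' [Jc' Sc']] := div _ _ OJ Og _ Jvu.
set r := v - _; suff -> : r = v - u - \sum_j c' j *: g j.
  move=> i l; rewrite mxE; apply: (coef_inD OJ); first exact: Jvu.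
  rewrite mxE summxE -[- _]sub0r; apply: (coef_inB OJ); first exact: (coef_in0 OJ).
  elim/big_rec: _ => [|t a _ Ja]; first exact: (coef_in0 OJ).
  by rewrite mxE mulrC; apply: (coef_inD OJ) => //; apply: (coef_inM OJ); [apply: Og|].
apply/eqP; rewrite -subr_eq0; apply/eqP; apply: StdN; first exact: StdB.
suff -> : r - (v - u - \sum_j c' j *: g j) =
    u - (\sum_j c j *: g j - \sum_j c' j *: g j).
  by apply: submoduleB => //; apply: submoduleB.
rewrite /r !opprB; set x := \sum_j _; set y := \sum_j _.
by rewrite [v - x]addrC addrACA [v + _]addrC subrK addrC [- x + y]addrC.
Qed.

(** Hilbert's basis theorem, from the fact that elements of N have standard remainder 0. *)
Lemma noetherian_row p : noetherian 'rV[R]_p.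
Proof.
move=> N subN; have [T [g [Std [gN _ StdN div]]]] := division_module subN.
exists (codom g); split=> [z /codomP[j ->]|f Nf] //.
have [|||c [_ Sc]] := div (fun=> True) (fun=> True) _ _ f; do 1?[by []].
have /eqP : f - \sum_j c j *: g j = 0.
  apply: StdN => //; apply: submoduleB => //; apply: submodule_sum => // j _.
  by have [_ _ NZ] := subN; apply: NZ.
rewrite subr_eq0 => /eqP->; apply: submodule_sum => [|j _]; first exact: submodule_span.
by have [_ _ sZ] := submodule_span (codom g); apply: sZ; apply: mem_span; apply: codom_f.
Qed.

Lemma noetherian_mpoly : noetherian R^o.
Proof.
move=> N subN; have [T [g [Std [gN _ StdN div]]]] := @division_ideal N subN.
exists (codom g); split=> [z /codomP[j ->]|f Nf] //.
have [|||c [_ Sc]] := div (fun=> True) (fun=> True) _ _ f; do 1?[by []].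
have /eqP : f - \sum_j c j * g j = 0.
  apply: StdN => //; apply: (submoduleB subN) => //.
  by apply: (submodule_sum _ subN) => j _; have [_ _ NZ] := subN; apply: NZ.
rewrite subr_eq0 => /eqP->; apply: (submodule_sum _ (submodule_span _)) => j _.
have [_ _ sZ] := @submodule_span _ R^o (codom g).
by apply: (sZ (c j) (g j)); apply: mem_span; apply: codom_f.
Qed.

End Division.

(** * Specialization *)

Section Places.
Variables (k K : fieldType) (iota : {rmorphism k -> K}) (m n : nat).
Local Notation R := (gen_ring k m n).

Section At.
Variable alpha : 'I_m -> K.
Local Notation Ra := (spec_ring iota alpha n).
Local Notation ev := (eval_adjoin iota alpha).
Local Notation is_spec := (@is_spec k K iota m n alpha).

Lemma eval_adjoin_neq0 f : eval_at iota alpha f != 0 -> ev f != 0.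
Proof. by apply: contra => /eqP/(congr1 val)/= ->. Qed.

Lemma tofrac_neq0 q : ev q != 0 -> tofrac q != 0.
Proof. by apply: contra_neq => /eqP; rewrite tofrac_eq0 => /eqP->; rewrite rmorph0. Qed.

Lemma is_spec_incl p : is_spec (gen_incl p) (eval_poly iota alpha p).
Proof. by exists p, 1; rewrite !rmorph1 oner_eq0 !invr1 !scale1r. Qed.

Lemma is_specD a b a' b' : is_spec a b -> is_spec a' b' -> is_spec (a + a') (b + b').
Proof.
move=> [p [q [q0 -> ->]]] [p' [q' [q'0 -> ->]]].
exists (q' *: p + q *: p'), (q * q').
have addZ (F : fieldType) (V : lmodType F) (c c' : F) (v v' : V) :
    c != 0 -> c' != 0 -> c^-1 *: v + c'^-1 *: v' = (c * c')^-1 *: (c' *: v + c *: v').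
  move=> c0 c'0; rewrite scalerDr !scalerA invfM.
  by rewrite -mulrA mulVf // mulr1 mulrAC mulVf // mul1r.
rewrite !rmorphM mulf_neq0 //; split=> //.
  by rewrite addZ ?tofrac_neq0 // /gen_incl rmorphD /= !map_mpolyZ.
by rewrite addZ // /eval_poly rmorphD /= !map_mpolyZ.
Qed.

Lemma is_specM a b a' b' : is_spec a b -> is_spec a' b' -> is_spec (a * a') (b * b').
Proof.
move=> [p [q [q0 -> ->]]] [p' [q' [q'0 -> ->]]].
exists (p * p'), (q * q'); rewrite !rmorphM mulf_neq0 //; split=> //.
  by rewrite -scalerAl -scalerAr scalerA invfM /gen_incl rmorphM.
by rewrite -scalerAl -scalerAr scalerA invfM /eval_poly rmorphM.
Qed.

Lemma is_spec0 : is_spec 0 0.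
Proof. by have := is_spec_incl 0; rewrite /gen_incl /eval_poly !rmorph0. Qed.

Lemma is_spec1 : is_spec 1 1.
Proof. by have := is_spec_incl 1; rewrite /gen_incl /eval_poly !rmorph1. Qed.

Lemma is_specN a b : is_spec a b -> is_spec (- a) (- b).
Proof.
move=> ab; rewrite -[a]mul1r -[b]mul1r -!mulNr; apply: is_specM => //.
by have := is_spec_incl (-1); rewrite /gen_incl /eval_poly !rmorphN !rmorph1.
Qed.

Lemma is_specB a b a' b' : is_spec a b -> is_spec a' b' -> is_spec (a - a') (b - b').
Proof. by move=> ab ab'; apply: is_specD => //; apply: is_specN. Qed.

Lemma is_spec_sum (T : Type) (r : seq T) (F : T -> R) (G : T -> Ra) :
  (forall i, is_spec (F i) (G i)) -> is_spec (\sum_(i <- r) F i) (\sum_(i <- r) G i).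
Proof.
by move=> FG; elim/big_rec2: _ => [|i b a _]; [exact: is_spec0|exact: is_specD].
Qed.

Lemma is_specX mm : is_spec 'X_[mm] 'X_[mm].
Proof. by have := is_spec_incl 'X_[mm]; rewrite /gen_incl /eval_poly !map_mpolyX. Qed.

Lemma is_spec_frac p q : ev q != 0 ->
  is_spec (tofrac p / tofrac q)%:MP (ev p / ev q)%:MP.
Proof.
move=> q0; exists p%:MP, q; split=> //.
  by rewrite /gen_incl map_mpolyC -mul_mpolyC -mpolyCM mulrC.
by rewrite /eval_poly map_mpolyC -mul_mpolyC -mpolyCM mulrC.
Qed.

Lemma is_spec_surj b : exists a, is_spec a b.
Proof.
elim/mpolyind: b => [|c mm b _ _ [a ab]]; first by exists 0; apply: is_spec0.
suff [d dc] : exists d, is_spec d c%:MP.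
  exists (d * 'X_[mm] + a); apply: is_specD => //; rewrite -mul_mpolyC.
  by apply: is_specM => //; apply: is_specX.
have /asboolP[p [q [q0 cE]]] := valP c.
exists (tofrac p / tofrac q)%:MP.
suff -> : c = ev p / ev q by apply: is_spec_frac; apply: eval_adjoin_neq0.
by apply: val_inj; rewrite cE fmorph_div.
Qed.

Lemma is_spec_coef a b mm : is_spec a b -> is_spec (a@_mm)%:MP (b@_mm)%:MP.
Proof.
move=> [p [q [q0 -> ->]]]; rewrite !mcoeffZ /gen_incl /eval_poly !mcoeff_map_mpoly.
by rewrite [_ * tofrac _]mulrC [_ * ev _]mulrC; apply: is_spec_frac.
Qed.

(* The local ring of k[u] at the kernel of evaluation at alpha, inside k(u), and its
   maximal ideal; the residue field is k(alpha). *)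
Definition place_ring (c : {fraction {mpoly k[m]}}) : Prop :=
  exists b, is_spec c%:MP b.
Definition place_ideal (c : {fraction {mpoly k[m]}}) : Prop := is_spec c%:MP 0.

Lemma place_ring_closed : module_over place_ring place_ring.
Proof.
split=> [|a b [a' aa'] [b' bb']|a b [a' aa'] [b' bb']].
- by exists 0; rewrite mpolyC0; apply: is_spec0.
- by exists (a' - b'); rewrite mpolyCB; apply: is_specB.
- by exists (a' * b'); rewrite mpolyCM; apply: is_specM.
Qed.

Lemma place_ideal_closed : module_over place_ring place_ideal.
Proof.
split=> [|a b aa' bb'|a b [a' aa'] bb']; rewrite /place_ideal.
- by rewrite mpolyC0; apply: is_spec0.
- by rewrite mpolyCB -[0]subr0; apply: is_specB.
- by rewrite mpolyCM -[0](mulr0 a'); apply: is_specM.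
Qed.

Lemma is_spec_coef_in a b : is_spec a b -> coef_in place_ring a.
Proof. by move=> ab mm; exists (b@_mm)%:MP; apply: is_spec_coef. Qed.

Lemma coef_in_place_ring a : coef_in place_ring a -> exists b, is_spec a b.
Proof.
move=> Oa; have [b ab] := choice Oa.
exists (\sum_(mm <- msupp a) b mm * 'X_[mm]); rewrite [a in is_spec a _]mpolyE.
apply: is_spec_sum => mm; rewrite -mul_mpolyC.
by apply: is_specM => //; apply: is_specX.
Qed.

Lemma is_spec_coef_in0 a : is_spec a 0 <-> coef_in place_ideal a.
Proof.
split=> [a0 mm|Pa].
  by have := is_spec_coef mm a0; rewrite mcoeff0 mpolyC0.
have -> : 0 = \sum_(mm <- msupp a) 0 * 'X_[mm] :> Ra.
  by rewrite big1 // => mm _; rewrite mul0r.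
rewrite [a in is_spec a _]mpolyE; apply: is_spec_sum => mm; rewrite -mul_mpolyC.
by apply: is_specM; [apply: Pa|apply: is_specX].
Qed.

Lemma specE a b : is_spec a b -> spec iota alpha a = b.
Proof.
move=> ab; rewrite /spec; case: pselect => [h|[]]; last by exists b.
by case: (cid h) => c /= ac; apply: is_spec_uniq ac ab.
Qed.

Definition is_spec_mx (p q : nat) (A : 'M[R]_(p, q)) (B : 'M[Ra]_(p, q)) : Prop :=
  forall i j, is_spec (A i j) (B i j).

Lemma is_spec_mxD p q (A A' : 'M[R]_(p, q)) B B' :
  is_spec_mx A B -> is_spec_mx A' B' -> is_spec_mx (A + A') (B + B').
Proof. by move=> AB AB' i j; rewrite !mxE; apply: is_specD. Qed.

Lemma is_spec_mxB p q (A A' : 'M[R]_(p, q)) B B' :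
  is_spec_mx A B -> is_spec_mx A' B' -> is_spec_mx (A - A') (B - B').
Proof. by move=> AB AB' i j; rewrite !mxE; apply: is_specB. Qed.

Lemma is_spec_mxZ p q a b (A : 'M[R]_(p, q)) B :
  is_spec a b -> is_spec_mx A B -> is_spec_mx (a *: A) (b *: B).
Proof. by move=> ab AB i j; rewrite !mxE; apply: is_specM. Qed.

Lemma is_spec_mxM p q r (A : 'M[R]_(p, q)) B (A' : 'M[R]_(q, r)) B' :
  is_spec_mx A B -> is_spec_mx A' B' -> is_spec_mx (A *m A') (B *m B').
Proof.
by move=> AB AB' i j; rewrite !mxE; apply: is_spec_sum => l; apply: is_specM.
Qed.

Lemma is_spec_mx0 p q : is_spec_mx (0 : 'M[R]_(p, q)) 0.
Proof. by move=> i j; rewrite !mxE; apply: is_spec0. Qed.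

Lemma is_spec_mx_surj p q (B : 'M[Ra]_(p, q)) : exists A, is_spec_mx A B.
Proof.
have /choice[A AB] (ij : 'I_p * 'I_q) := is_spec_surj (B ij.1 ij.2).
by exists (\matrix_(i, j) A (i, j)) => i j; rewrite mxE; apply: (AB (i, j)).
Qed.

Lemma mx_in_place_ring p q (A : 'M[R]_(p, q)) :
  mx_in place_ring A -> exists B, is_spec_mx A B.
Proof.
move=> OA; have /choice[B AB] (ij : 'I_p * 'I_q) := coef_in_place_ring (OA ij.1 ij.2).
by exists (\matrix_(i, j) B (i, j)) => i j; rewrite mxE; apply: (AB (i, j)).
Qed.

Lemma is_spec_mx_in p q (A : 'M[R]_(p, q)) B : is_spec_mx A B -> mx_in place_ring A.
Proof. by move=> AB i j; apply: is_spec_coef_in (AB i j). Qed.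

Lemma is_spec_mx_in0 p q (A : 'M[R]_(p, q)) : is_spec_mx A 0 <-> mx_in place_ideal A.
Proof.
by split=> A0 i j; [|rewrite mxE]; apply/is_spec_coef_in0; have := A0 i j; rewrite ?mxE.
Qed.

Lemma is_spec_mx_uniq p q (A : 'M[R]_(p, q)) B B' :
  is_spec_mx A B -> is_spec_mx A B' -> B = B'.
Proof. by move=> AB AB'; apply/matrixP => i j; apply: is_spec_uniq (AB i j) (AB' i j). Qed.

(** The image of the integral part of N, where O is the local ring at [alpha]: N is intersected with
    O[x]^p before reducing modulo P. *)
Definition spec_sub p (N : 'rV[R]_p -> Prop) (w : 'rV[Ra]_p) : Prop :=
  exists2 v, N v & is_spec_mx v w.

(** Generators and coefficients both lift to O[x], so the generated ideal is already the image of
    the part of I in O[x]. *)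
Lemma spec_idealP (I : R -> Prop) b : is_ideal I ->
  spec_ideal iota alpha I b <-> exists2 a, I a & is_spec a b.
Proof.
move=> [I0 ID IM]; split=> [[r [c [g [gP ->]]]]|[a Ia [p [q [q0 aE ->]]]]].
  have [a aI] := choice (fun j => let: ex_intro2 f If gE := gP j in
    ex_intro (fun a => I a /\ is_spec a (g j)) (gen_incl f)
      (conj If (eq_ind_r (is_spec _) (is_spec_incl f) gE))).
  have [d dc] := choice (fun j => is_spec_surj (c j)).
  exists (\sum_j d j * a j).
    by apply: big_ind => // j _; apply: IM; case: (aI j).
  by apply: is_spec_sum => j; apply: is_specM => //; case: (aI j).
(* Clearing the denominator q keeps the element in I, and q becomes a unit at [alpha]. *)
exists 1%N, (fun=> ((ev q)^-1)%:MP), (fun=> eval_poly iota alpha p); split=> [_|].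
  exists p => //; suff -> : gen_incl p = (tofrac q)%:MP * a by apply: IM.
  by rewrite aE mul_mpolyC scalerA divff ?tofrac_neq0 // scale1r.
by rewrite big_ord1 mul_mpolyC.
Qed.

End At.

End Places.

(** * Properties that hold off a hypersurface *)

Section Generic.
Variables (k K : fieldType) (iota : {rmorphism k -> K}) (m n : nat).
Local Notation R := (gen_ring k m n).

(** Asks for a nonzero polynomial rather than a point where it is nonzero: since k[u] is a domain,
    products then handle finite conjunctions. *)
Definition generic (P : ('I_m -> K) -> Prop) : Prop :=
  exists2 h : {mpoly k[m]}, h != 0 & forall alpha, eval_at iota alpha h != 0 -> P alpha.

Lemma genericW (P P' : ('I_m -> K) -> Prop) :
  (forall alpha, P alpha -> P' alpha) -> generic P -> generic P'.
Proof. by move=> PP' [h h0 hP]; exists h => // alpha /hP/PP'. Qed.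

Lemma genericT (P : ('I_m -> K) -> Prop) : (forall alpha, P alpha) -> generic P.
Proof. by move=> allP; exists 1 => //; rewrite oner_eq0. Qed.

Lemma generic_and (P P' : ('I_m -> K) -> Prop) :
  generic P -> generic P' -> generic (fun alpha => P alpha /\ P' alpha).
Proof.
move=> [h h0 hP] [h' h'0 hP']; exists (h * h'); first by rewrite mulf_neq0.
by move=> alpha; rewrite rmorphM mulf_eq0 negb_or => /andP[/hP ? /hP'].
Qed.

Lemma generic_all (T : finType) (P : T -> ('I_m -> K) -> Prop) :
  (forall t, generic (P t)) -> generic (fun alpha => forall t, P t alpha).
Proof.
move=> genP; suff : generic (fun alpha => forall t, t \in enum T -> P t alpha).
  by apply: genericW => alpha Pa t; apply: Pa; rewrite mem_enum.
elim: (enum T) => [|t s IH]; first by apply: genericT.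
apply: genericW (generic_and (genP t) IH) => alpha [Pt Ps] u.
by rewrite inE => /orP[/eqP->|/Ps].
Qed.

Lemma frac_eq_div (D : idomainType) (c : {fraction D}) :
  exists x y, y != 0 /\ c = tofrac x / tofrac y.
Proof.
elim/quotW: c => r; exists \n_r, \d_r; split; first exact: denom_ratioP.
have d0 : tofrac \d_r != 0 by rewrite tofrac_eq0; apply: denom_ratioP.
apply: (mulIf d0); rewrite divfK //; unlock tofrac.
rewrite -[LHS]FracField.pi_mul; apply/eqmodP.
rewrite /= FracField.equivfE /FracField.mulf.
by rewrite !numden_Ratio ?mulr1 ?mul1r ?denom_ratioP ?oner_eq0 // mulrC.
Qed.

Lemma generic_is_spec (a : R) :
  generic (fun alpha => exists b, is_spec (iota := iota) (alpha := alpha) a b).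
Proof.
elim/mpolyind: a => [|c mm a _ _ IH].
  by apply: genericT => alpha; exists 0; apply: is_spec0.
have [x [y [y0 ->]]] := frac_eq_div c.
suff : generic (fun alpha =>
    exists b, is_spec (iota := iota) (alpha := alpha) (tofrac x / tofrac y)%:MP_[n] b).
  move=> genx; apply: (genericW _ (generic_and genx IH)) => alpha [[b xb] [b' ab']].
  exists (b * 'X_[mm] + b'); apply: is_specD => //; rewrite -mul_mpolyC.
  by apply: is_specM => //; apply: is_specX.
exists y => // alpha /eval_adjoin_neq0 ay0.
exists (eval_adjoin iota alpha x / eval_adjoin iota alpha y)%:MP.
exact: is_spec_frac.
Qed.

Lemma generic_is_spec_mx p q (A : 'M[R]_(p, q)) :
  generic (fun alpha => exists B, is_spec_mx (iota := iota) (alpha := alpha) A B).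
Proof.
suff : generic (fun alpha => forall ij : 'I_p * 'I_q,
    exists b, is_spec (iota := iota) (alpha := alpha) (A ij.1 ij.2) b).
  apply: genericW => alpha /choice[B AB].
  by exists (\matrix_(i, j) B (i, j)) => i j; rewrite mxE; apply: (AB (i, j)).
by apply: generic_all => ij; apply: generic_is_spec.
Qed.

(** The leading coefficient x / y is a unit of the local ring wherever x and y are both nonzero. *)
Lemma generic_not_is_spec0 (a : R) : a != 0 ->
  generic (fun alpha => ~ is_spec (iota := iota) (alpha := alpha) a 0).
Proof.
rewrite -mleadc_eq0; set c := mleadc a => c0.
have [x [y [y0 cE]]] := frac_eq_div c.
have x0 : x != 0 by apply: contraNneq c0 => x0; rewrite cE x0 rmorph0 mul0r.
exists (x * y) => [|alpha]; first by rewrite mulf_neq0.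
rewrite rmorphM mulf_eq0 negb_or => /andP[/eval_adjoin_neq0 ax0 /eval_adjoin_neq0 ay0].
move=> /(is_spec_coef (mlead a)); rewrite -/c cE mcoeff0 mpolyC0 => c_spec0.
have := is_spec_uniq c_spec0 (is_spec_frac n x ay0); move=> /eqP.
by rewrite eq_sym mpolyC_eq0 mulf_eq0 invr_eq0 (negPf ax0) (negPf ay0).
Qed.

(** One hypersurface serves all J and f, since only the finitely many [g t] and [w t] must be
    integral at [alpha]. *)
Lemma generic_lift_sum p q (C : 'M[R]_(q, p)) (N : 'rV[R]_p -> Prop) : submodule N ->
  generic (fun alpha => forall J, module_over (place_ring iota n alpha) J ->
    forall f : 'rV[R]_p, mx_in J f -> (exists w, N (f - w *m C)) ->
    exists2 w, mx_in J w & N (f - w *m C)).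
Proof.
move=> subN; have [T [g [w lift]]] := lift_sum C subN.
have : generic (fun alpha => forall t,
    (exists B, is_spec_mx (iota := iota) (alpha := alpha) (g t) B) /\
    (exists B, is_spec_mx (iota := iota) (alpha := alpha) (w t) B)).
  by apply: generic_all => t; apply: generic_and; apply: generic_is_spec_mx.
apply: genericW => alpha gw J OJ; apply: (lift _ _ OJ) => t.
  by have [[B gB] _] := gw t; apply: is_spec_mx_in gB.
by have [_ [B wB]] := gw t; apply: is_spec_mx_in wB.
Qed.

End Generic.

(** * Specialization of preimages, sums, nonmembership and grade *)

Section GenericGrade.
Variables (k K : fieldType) (iota : {rmorphism k -> K}) (m n : nat).
Local Notation R := (gen_ring k m n).
Local Notation Ra alpha := (spec_ring iota alpha n).
Local Notation generic := (generic iota).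

(** An arbitrary lift w of w' satisfies w C in N only modulo P. Lifting with J = P gives a
    correction x that vanishes at [alpha], and w - x is an exact lift. *)
Lemma generic_preimage p q (C : 'M[R]_(q, p)) (N : 'rV[R]_p -> Prop) : submodule N ->
  generic (fun alpha => forall C' : 'M[Ra alpha]_(q, p), is_spec_mx C C' ->
    forall w' : 'rV[Ra alpha]_q, spec_sub N (w' *m C') ->
    spec_sub (fun w => N (w *m C)) w').
Proof.
move=> subN; apply: genericW (generic_lift_sum iota C subN) => alpha lift C' CC' w'.
have [w ww'] := is_spec_mx_surj w' => -[u Nu uwC].
have [x x0 Nx] : exists2 x, is_spec_mx (iota := iota) (alpha := alpha) x 0 &
    N (w *m C - u - x *m C).
  have f0 : mx_in (place_ideal iota n alpha) (w *m C - u).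
    apply/is_spec_mx_in0; rewrite -(subrr (w' *m C')).
    by apply: is_spec_mxB => //; apply: is_spec_mxM.
  have [|x x0 Nx] := lift _ (place_ideal_closed _ _ _) _ f0; last first.
    by exists x => //; apply/is_spec_mx_in0.
  by exists w; rewrite addrAC subrr sub0r -scaleN1r; have [_ _ NZ] := subN; apply: NZ.
exists (w - x); last by rewrite -[w']subr0; apply: is_spec_mxB.
have [_ ND _] := subN; have := ND _ _ Nx Nu.
by rewrite mulmxBl addrAC subrK.
Qed.

(** The delicate inclusion is from left to right: in v - a w the vector w may have poles at [alpha],
    and lifting with J = O replaces it by an integral one. *)
Lemma generic_spec_add_mul p (a : R) (N : 'rV[R]_p -> Prop) : submodule N ->
  generic (fun alpha => forall a' : Ra alpha, is_spec a a' ->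
    spec_sub (add_mul a N) = add_mul a' (spec_sub N)).
Proof.
move=> subN; apply: genericW (generic_lift_sum iota a%:M subN) => alpha lift a' aa'.
apply: funext => v'; apply: propext; split=> [[v [w Nvw] vv']|[w' [u Nu uv']]].
  have Ov := is_spec_mx_in vv'.
  have [|x Ox] := lift _ (place_ring_closed _ _ _) _ Ov.
    by exists w; rewrite mul_mx_scalar.
  rewrite mul_mx_scalar => Nx; have [x' xx'] := mx_in_place_ring Ox.
  exists x'; exists (v - a *: x) => //.
  by apply: is_spec_mxB => //; apply: is_spec_mxZ.
have [w ww'] := is_spec_mx_surj w'.
exists (u + a *: w); first by exists w; rewrite addrK.
by rewrite -[v'](subrK (a' *: w')); apply: is_spec_mxD => //; apply: is_spec_mxZ.
Qed.

(** If some u in N had the same specialization as v, the normal form of v would have all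
    coefficients in P, but one of its entries is generically nonzero. *)
Lemma generic_notin p (N : 'rV[R]_p -> Prop) v : submodule N -> ~ N v ->
  generic (fun alpha => forall v' : 'rV[Ra alpha]_p, is_spec_mx v v' -> ~ spec_sub N v').
Proof.
move=> subN nNv; have [T [g [r [r0 rem]]]] := nonzero_remainder subN nNv.
have [j rj0] : exists j, r 0 j != 0.
  apply: contrapT => nor; move/eqP: r0; apply; apply/rowP => j; rewrite mxE.
  by apply/eqP; apply: contrapT => /negP rj; apply: nor; exists j.
have gen_g : generic (fun alpha => forall t,
    exists B, is_spec_mx (iota := iota) (alpha := alpha) (g t) B).
  by apply: generic_all => t; apply: generic_is_spec_mx.
apply: genericW (generic_and gen_g (generic_not_is_spec0 iota rj0)).
move=> alpha [specg rj] v' vv' [u Nu uv'].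
apply: rj; apply/is_spec_coef_in0.
have Og t : mx_in (place_ring iota n alpha) (g t).
  by have [B gB] := specg t; apply: is_spec_mx_in gB.
apply: (rem _ _ (place_ideal_closed iota n alpha) Og u Nu).
by apply/is_spec_mx_in0; rewrite -(subrr v'); apply: is_spec_mxB.
Qed.

Lemma generic_spec_image p q (A : 'M[R]_(q, p)) :
  generic (fun alpha => forall A' : 'M[Ra alpha]_(q, p), is_spec_mx A A' ->
    forall v', spec_sub (fun v => exists w, w *m A = v) v' <-> exists w', w' *m A' = v').
Proof.
have sub0 : submodule (fun v : 'rV[R]_p => v = 0).
  by split=> [//|u w -> ->|a u ->]; rewrite ?addr0 ?scaler0.
apply: genericW (generic_lift_sum iota A sub0) => alpha lift A' AA' v'.
split=> [[v [w wA] vv']|[w' <-]]; last first.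
  have [w ww'] := is_spec_mx_surj w'.
  by exists (w *m A); [exists w|apply: is_spec_mxM].
have [|x Ox /eqP] := lift _ (place_ring_closed _ _ _) _ (is_spec_mx_in vv').
  by exists w; rewrite wA subrr.
rewrite subr_eq0 => /eqP vE; have [x' xx'] := mx_in_place_ring Ox.
exists x'; apply: is_spec_mx_uniq vv'; rewrite vE; exact: is_spec_mxM.
Qed.

Lemma spec_is_spec alpha (a : R) : (exists b : Ra alpha, is_spec a b) ->
  is_spec a (spec iota alpha a).
Proof. by move=> [b ab]; rewrite (specE ab). Qed.

(** A nonzerodivisor is expressed by (N : a) = N, and (N : a) is the preimage of N under the scalar
    matrix a, which specializes; sums N + aV specialize too. *)
Lemma generic_weakly_regular p (N : 'rV[R]_p -> Prop) s : submodule N ->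
  weakly_regular N s ->
  generic (fun alpha => let s' := map (spec iota alpha) s in
    weakly_regular (spec_sub (iota := iota) (alpha := alpha) N) s' /\
    spec_sub (add_muls N s) = add_muls (spec_sub N) s').
Proof.
elim: s N => [|a s IH] N subN /=; first by move=> _; apply: genericT.
move=> [nza wrs].
have := generic_and (IH _ (submodule_add_mul a subN) wrs) (generic_and
  (generic_is_spec iota a) (generic_and (generic_spec_add_mul a subN)
    (generic_preimage a%:M subN))).
apply: genericW => alpha [[wrs' add_s] [/spec_is_spec aa' [add_a colon_a]]].
rewrite -(add_a _ aa'); split=> //; split=> // v' Nav'.
have [||v Nav vv'] := colon_a (spec iota alpha a)%:M _ v'.
- by move=> i j; rewrite !mxE; case: eqP => _; [exact: aa'|exact: is_spec0].
- by rewrite mul_mx_scalar.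
by exists v => //; apply: nza; rewrite -mul_mx_scalar.
Qed.

Lemma is_ideal_spec_ideal alpha (I : R -> Prop) : is_ideal I ->
  is_ideal (spec_ideal iota alpha I).
Proof.
move=> idI; have [I0 ID IM] := idI.
split=> [|a' b' /(spec_idealP _ idI)[a Ia aa'] /(spec_idealP _ idI)[b Ib bb']
  |a' b' /(spec_idealP _ idI)[b Ib bb']]; apply/(spec_idealP _ idI).
- by exists 0 => //; apply: is_spec0.
- by exists (a + b); [apply: ID|apply: is_specD].
- have [a aa'] := is_spec_surj a'.
  by exists (a * b); [apply: IM|apply: is_specM].
Qed.

Lemma generic_spec_seq (s : seq R) : generic (fun alpha =>
  forall a, a \in s -> is_spec a (spec iota alpha a)).
Proof.
elim: s => [|a s IH]; first by apply: genericT.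
apply: genericW (generic_and (generic_is_spec iota a) IH) => alpha [/spec_is_spec aa' ss'] b.
by rewrite inE => /orP[/eqP->|/ss'].
Qed.

(** L and L' are any modules presented by N and its specialization, so that the ring as a module
    over itself is covered besides the cokernels. *)
Lemma generic_grade p (N : 'rV[R]_p -> Prop) (I : R -> Prop) : submodule N -> is_ideal I ->
  generic (fun alpha => forall (L : lmodType R) (L' : lmodType (Ra alpha))
    (pi : {linear 'rV[R]_p -> L}) (pi' : {linear 'rV[Ra alpha]_p -> L'}),
    (forall y, exists v, pi v = y) -> (forall v, pi v = 0 <-> N v) ->
    (forall y, exists v, pi' v = y) -> (forall v, pi' v = 0 <-> spec_sub N v) ->
    grade (spec_ideal iota alpha I) L' = grade I L).
Proof.
move=> subN idI; pose M := add_ideal N I.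
have subM : submodule M.
  have [N0 ND NZ] := subN; have [m0 mD mZ] := submodule_ideal_mul I 'rV[R]_p.
  split=> [|u v [x mx Nx] [y my Ny]|a v [x mx Nx]].
  - by exists 0; rewrite ?subr0.
  - by exists (x + y); [apply: mD|rewrite opprD addrACA; apply: ND].
  - by exists (a *: x); [apply: mZ|rewrite -scalerBr; apply: NZ].
have [allM|nallM] := pselect (forall v, M v).
  (* Here L = IL. It suffices to specialize one expression of each unit vector as an element of N +
     IV. *)
  have : generic (fun alpha => forall i : 'I_p,
      add_ideal (spec_sub (iota := iota) (alpha := alpha) N)
        (spec_ideal iota alpha I) (delta_mx 0 i)).
    apply: generic_all => i.
    have [u [r [a [w [aI uE]]]] Nu] := allM (delta_mx 0 i).
    have : generic (fun alpha => forall j,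
        (exists b : Ra alpha, is_spec (a j) b) /\
        (exists B : 'rV[Ra alpha]_p, is_spec_mx (w j) B)).
      apply: generic_all => j; apply: generic_and; first exact: generic_is_spec.
      exact: generic_is_spec_mx.
    apply: genericW => alpha aw.
    have [a' aa'] := choice (fun j => (aw j).1).
    have [w' ww'] := choice (fun j => (aw j).2).
    exists (\sum_j a' j *: w' j).
      exists r, a', w'; split=> // j.
      by apply/(spec_idealP _ idI); exists (a j).
    exists (delta_mx 0 i - u) => //; apply: is_spec_mxB.
      by move=> i1 i2; rewrite !mxE; case: (_ && _); [exact: is_spec1|exact: is_spec0].
    rewrite uE => i1 i2; rewrite !summxE; apply: is_spec_sum => j.
    exact: is_spec_mxZ.
  apply: genericW => alpha all' L L' pi pi' pi_surj pi_ker pi'_surj pi'_ker.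
  rewrite (grade_None pi_surj pi_ker) // (grade_None pi'_surj pi'_ker) // => v'.
  rewrite [v']row_sum_delta; apply: submodule_sum; last first.
    move=> i _; have [_ _ sZ] := submodule_add_ideal pi'_ker (spec_ideal iota alpha I).
    by apply: sZ.
  exact: (submodule_add_ideal pi'_ker).
have [v nMv] : exists v, ~ M v.
  by apply: contrapT => nov; apply: nallM => v; apply: contrapT => nv; apply: nov; exists v.
have [|||s [sI wrs [z nz Iz]]] := exists_regular_socle (@noetherian_mpoly _ n)
    (@noetherian_row _ n p) idI subN subM.
- by move=> u Nu; exists 0; rewrite ?subr0 //; have [] := submodule_ideal_mul I 'rV[R]_p.
- move=> a u Ia; exists (a *: u); first exact: ideal_mul_scale.
  by rewrite subrr; case: subN.
- by exists v.
have subs := submodule_add_muls s subN.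
have := generic_and (generic_and (generic_is_spec_mx iota v) (generic_notin subM nMv))
  (generic_and (generic_and (generic_is_spec_mx iota z) (generic_notin subs nz))
    (generic_and (generic_spec_seq s) (generic_weakly_regular subN wrs))).
apply: genericW => alpha [[[v' vv'] nM'] [[[z' zz'] nz'] [ss' [wrs' add_s']]]].
move=> L L' pi pi' pi_surj pi_ker pi'_surj pi'_ker.
have socs : has_socle I (add_muls N s) by exists z.
rewrite (grade_Some pi_surj pi_ker (@noetherian_mpoly _ n) (@noetherian_row _ n p)
  idI _ sI wrs socs); last by move=> all; apply: nMv; apply: all.
rewrite -(size_map (spec iota alpha)).
apply: (grade_Some pi'_surj pi'_ker (@noetherian_mpoly _ n) (@noetherian_row _ n p)) => //.
- exact: is_ideal_spec_ideal.
(* An expression of v' in the specialized N + IV lifts term by term to an element of M specializing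
   to v', contrary to the choice of v outside M. *)
- move=> all; have [u' [r [a' [w' [a'I u'E]]]] [x Nx xv']] := all v'.
  have [a aI] := choice (fun j => let: ex_intro2 a Ia aa' :=
    (iffLR (spec_idealP _ idI) (a'I j)) in
    ex_intro (fun a => I a /\ is_spec a (a' j)) a (conj Ia aa')).
  have [w ww'] := choice (fun j => is_spec_mx_surj (w' j)).
  apply: (nM' v' vv'); exists (x + \sum_j a j *: w j).
    exists (\sum_j a j *: w j); last by rewrite addrK.
    by exists r, a, w; split=> // j; case: (aI j).
  rewrite -[v'](subrK u'); apply: is_spec_mxD => //.
  rewrite u'E => i1 i2; rewrite !summxE; apply: is_spec_sum => j.
  by apply: is_spec_mxZ => //; case: (aI j).
- move=> b /mapP[a sa ->]; apply/(spec_idealP _ idI).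
  by exists a; [apply: sI|apply: ss'].
- exists z'; first by rewrite -add_s'; apply: nz'.
  move=> b' /(spec_idealP _ idI)[b Ib bb']; rewrite -add_s'.
  by exists (b *: z); [apply: Iz|apply: is_spec_mxZ].
Qed.

End GenericGrade.

(** * Nonvanishing over an infinite field, and the theorem *)

Section Nonvanishing.
Variable k : fieldType.
Hypothesis k_infinite : infinite_field k.

Lemma infinite_poly_nonroot (P : {poly k}) : P != 0 -> exists t, P.[t] != 0.
Proof.
move=> P0; apply: contrapT => noroot.
have [s us sP] : exists2 s : seq k, uniq s & size s = size P.
  elim: (size P) => [|N [s us sN]]; first by exists [::].
  have [x xs] := k_infinite s; exists (x :: s); first by rewrite /= xs.
  by rewrite /= sN.
suff : (size s < size P)%N by rewrite sP ltnn.
apply: max_poly_roots => //; apply/allP => x _; apply/eqP.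
by apply: contrapT => /eqP Px; apply: noroot; exists x.
Qed.

Lemma coef_muni n (h : {mpoly k[n.+1]}) (mm : 'X_{1..n.+1}) :
  (muni h)`_(mm ord_max)@_[multinom mm (widen_ord (leqnSn n) i) | i < n] = h@_mm.
Proof.
rewrite muniE coef_sum raddf_sum /=.
rewrite (eq_bigr (fun mm' => h@_mm' * (mm' == mm)%:R)) => [|mm' _].
  have [mms|mms] := boolP (mm \in msupp h).
    rewrite (bigD1_seq mm) //= eqxx mulr1 big1 ?addr0 // => mm' /negPf->.
    by rewrite mulr0.
  rewrite (memN_msupp_eq0 mms) big_seq big1 // => mm' mm's.
  by case: eqP mm's => [->|_]; [rewrite (negPf mms)|rewrite mulr0].
rewrite coefZ coefXn; have [->|nmm'] := eqVneq mm' mm.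
  by rewrite eqxx !mulr1 mcoeffZ mcoeffX eqxx mulr1.
rewrite mulr0; case: eqP => [eq_max|_]; last by rewrite mulr0 mcoeff0.
rewrite mulr1 mcoeffZ mcoeffX; case: eqP => [eq_res|_]; last by rewrite mulr0.
case/eqP: nmm'; apply/mnmP => i; have [j ->|->] := unliftP ord_max i; last by [].
have -> : lift ord_max j = widen_ord (leqnSn n) j.
  by apply: val_inj; rewrite /= /bump leqNgt ltn_ord.
by move/mnmP/(_ j): eq_res; rewrite !mnmE.
Qed.

(** With h viewed as a polynomial in the last variable, b keeps alive the coefficient containing the
    leading monomial of h; a value t of the last variable then avoids the roots. *)
Lemma infinite_mpoly_nonroot n (h : {mpoly k[n]}) : h != 0 -> exists b, h.@[b] != 0.
Proof.
elim: n h => [|n IH] h h0.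
  have hE : h = (h@_0%MM)%:MP.
    apply/mpolyP => mm; have -> : mm = 0%MM by apply/mnmP => -[].
    by rewrite mcoeffC eqxx mulr1.
  by exists (fun=> 0); rewrite hE mevalC; move: h0; rewrite {1}hE mpolyC_eq0.
pose mm := mlead h.
have [|b b0] := IH (muni h)`_(mm ord_max).
  apply: contraNneq h0 => h0; rewrite -mleadc_eq0 -/mm -coef_muni.
  by rewrite h0 mcoeff0.
have [|t t0] := @infinite_poly_nonroot (map_poly (meval b) (muni h)).
  apply: contraNneq b0 => P0.
  by rewrite -coef_map P0 coef0.
exists (fun i => if unlift ord_max i is Some j then b j else t).
suff <- : (map_poly (meval b) (muni h)).[t] =
  h.@[fun i => if unlift ord_max i is Some j then b j else t] by [].
rewrite muniE rmorph_sum /= horner_sum [in RHS]mevalE.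
apply: eq_bigr => mm' _.
rewrite map_polyZ hornerZ /= map_polyXn hornerXn mevalZ mevalX -mulrA; congr (_ * _).
rewrite big_ord_recr /= unlift_none; congr (_ * _); apply: eq_bigr => i _.
have -> : widen_ord (leqnSn n) i = lift ord_max i.
  by apply: val_inj; rewrite /= /bump leqNgt ltn_ord.
by rewrite liftK mnmE; congr (_ ^+ mm' _); apply: val_inj; rewrite /= /bump leqNgt ltn_ord.
Qed.

End Nonvanishing.

Lemma generic_almost_all (k K : fieldType) (iota : {rmorphism k -> K}) (m : nat)
    (P : ('I_m -> K) -> Prop) :
  infinite_field k -> generic iota P -> almost_all P.
Proof.
move=> k_infinite [h h0 hP]; have [b hb] := infinite_mpoly_nonroot k_infinite h0.
exists (fun f => f = map_mpoly iota h); split=> [|alpha nz]; last first.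
  by apply: hP; apply/eqP => h_alpha; apply: nz => f ->.
(* The nonzero of h is found over k and transported to K along [iota]. *)
exists (iota \o b) => /(_ _ erefl)/eqP; apply/negP.
suff -> : (map_mpoly iota h).@[iota \o b] = iota h.@[b] by rewrite fmorph_eq0.
elim/mpolyind: h {h0 hP hb} => [|c mm h _ _ IH]; first by rewrite !rmorph0.
rewrite rmorphD !mevalD rmorphD /= IH; congr (_ + _).
rewrite map_mpolyZ map_mpolyX !mevalZ !mevalX rmorphM rmorph_prod; congr (_ * _).
by apply: eq_bigr => i _; rewrite rmorphXn.
Qed.

Section Presentations.
Variable S : comNzRingType.

(** Presents the regular module as a quotient of row vectors of length 1 with kernel 0, to fit the
    grade lemma. *)
Definition entry00 (v : 'rV[S]_1) : S^o := v 0 0.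

Fact entry00_linear : linear entry00.
Proof. by move=> a u v; rewrite /entry00 !mxE. Qed.

HB.instance Definition _ :=
  GRing.isLinear.Build S 'rV[S]_1 S^o *:%R entry00 entry00_linear.

Lemma entry00_surj (y : S^o) : exists v, entry00 v = y.
Proof. by exists (const_mx y); rewrite /entry00 mxE. Qed.

Lemma entry00_eq0 v : entry00 v = 0 <-> v = 0.
Proof.
split=> [v0|->]; last by rewrite /entry00 mxE.
by apply/rowP => j; rewrite ord1 mxE.
Qed.

Variables (U V : lmodType S) (f : {linear U -> V}).

Fact coker_pi_linear : linear (@coker_pi S U V f).
Proof. by move=> a u v; rewrite coker_piD -coker_scale_pi. Qed.

HB.instance Definition _ :=
  GRing.isLinear.Build S V (coker f) *:%R (@coker_pi S U V f) coker_pi_linear.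

Lemma is_ideal_Ann (L : lmodType S) : is_ideal (@Ann S L).
Proof.
split=> [v|a b a0 b0 v|a b b0 v]; first by rewrite scale0r.
  by rewrite scalerDl a0 b0 addr0.
by rewrite -scalerA b0 scaler0.
Qed.

End Presentations.

Section SpecAnn.
Variables (k K : fieldType) (iota : {rmorphism k -> K}) (m n p : nat).
Local Notation R := (gen_ring k m n).
Local Notation Ra alpha := (spec_ring iota alpha n).

(* a annihilates coker(N -> R^p) iff all rows of a%:M are in N, i.e. iff the vector
   mxvec 1%:M of R^(p * p) scaled by a is in N^p. *)
Lemma generic_Ann (N : 'rV[R]_p -> Prop) : submodule N ->
  generic iota (fun alpha => forall (L : lmodType R) (L' : lmodType (Ra alpha))
    (pi : {linear 'rV[R]_p -> L}) (pi' : {linear 'rV[Ra alpha]_p -> L'}),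
    (forall y, exists v, pi v = y) -> (forall v, pi v = 0 <-> N v) ->
    (forall y, exists v, pi' v = y) -> (forall v, pi' v = 0 <-> spec_sub N v) ->
    @Ann _ L' = spec_ideal iota alpha (@Ann _ L)).
Proof.
move=> subN; have [N0 ND NZ] := subN.
pose rows (S : comNzRingType) (M : 'rV[S]_p -> Prop) (v : 'rV[S]_(p * p)) : Prop :=
  forall i, M (row i (vec_mx v)).
have sub_rows : submodule (rows _ N).
  split=> [i|u v Nu Nv i|a v Nv i].
  - by rewrite linear0 row0.
  - by rewrite !linearD; apply: ND; [apply: Nu|apply: Nv].
  - by rewrite !linearZ; apply: NZ; apply: Nv.
apply: genericW (generic_preimage iota (mxvec 1%:M : 'M_(1, p * p)) sub_rows).
move=> alpha preim L L' pi pi' pi_surj pi_ker pi'_surj pi'_ker.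
have AnnP (a : R) : @Ann _ L a <-> forall v, N (a *: v).
  split=> [a0 v|Na y]; first by apply/pi_ker; rewrite linearZ /= a0.
  by have [v <-] := pi_surj y; rewrite -linearZ; apply/pi_ker.
apply: funext => a'; apply: propext; split=> [a'0|].
  have [||w Nw wa'] := preim (mxvec 1%:M) _ a'%:M.
  - move=> i j; rewrite ord1; case/mxvec_indexP: j => j1 j2; rewrite !mxvecE !mxE.
    by case: eqP => _; [exact: is_spec1|exact: is_spec0].
  - have rows' i : spec_sub N (a' *: delta_mx 0 i).
      by apply/pi'_ker; rewrite linearZ /= a'0.
    have [v vP] := choice (fun i => let: ex_intro2 v Nv vv' := rows' i in
      ex_intro (fun v => N v /\ is_spec_mx v (a' *: delta_mx 0 i)) v (conj Nv vv')).
    exists (mxvec (\matrix_i v i)).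
      by move=> i; rewrite mxvecK rowK; case: (vP i).
    move=> i j; case/mxvec_indexP: j => j1 j2.
    rewrite ord1 mul_scalar_mx mxE !mxvecE !mxE.
    have := (vP j1).2 0 j2; rewrite !mxE eqxx /=.
    by rewrite eq_sym.
  apply/(spec_idealP _ (is_ideal_Ann L)); exists (w 0 0).
    apply/AnnP => v; rewrite [v]row_sum_delta scaler_sumr.
    apply: submodule_sum => // i _; rewrite scalerA mulrC -scalerA; apply: NZ.
    have := Nw i; rewrite [w]mx11_scalar mul_scalar_mx linearZ /= mxvecK linearZ /=.
    by rewrite row1 mxE eqxx mulr1n.
  by have := wa' 0 0; rewrite mxE eqxx mulr1n.
move=> /(spec_idealP _ (is_ideal_Ann L))[a a0 aa'] y'.
have [v' <-] := pi'_surj y'; rewrite -linearZ; apply/pi'_ker.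
have [v vv'] := is_spec_mx_surj v'.
by exists (a *: v); [apply: (AnnP a).1|apply: is_spec_mxZ].
Qed.

End SpecAnn.

Theorem corollary4p4
    (k : fieldType) (k_infinite : infinite_field k)
    (K : fieldType) (iota : {rmorphism k -> K}) (m n : nat)
    (L : lmodType (gen_ring k m n)) (p q : nat)
    (phi : {linear 'rV[gen_ring k m n]_q -> 'rV[gen_ring k m n]_p})
    (pi : {linear 'rV[gen_ring k m n]_p -> L})
    (presL : free_presentation phi pi)
    (I : gen_ring k m n -> Prop) (idealI : is_ideal I) :
  almost_all (fun alpha : 'I_m -> K =>
    [/\ spec_hom_def iota alpha phi,
        grade (spec_ideal iota alpha I) (spec_module iota alpha phi)
          = grade I L
      & grade_module (spec_module iota alpha phi) = grade_module L]).
Proof.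
apply: (generic_almost_all k_infinite (iota := iota)).
have [pi_surj pi_ker] := presL.
pose A := lin1_mx phi; pose N (v : 'rV[gen_ring k m n]_p) := exists w, w *m A = v.
have piN v : pi v = 0 <-> N v.
  by split=> [/pi_ker[w <-]|[w <-]]; [exists w|apply/pi_ker; exists w];
    rewrite mul_rV_lin1.
have subN : submodule N by apply: submodule_ker piN.
have sub0 : submodule (fun v : 'rV[gen_ring k m n]_1 => v = 0).
  by apply: submodule_ker (@entry00_eq0 _).
have := generic_and (generic_is_spec_mx iota A) (generic_and (generic_spec_image iota A)
  (generic_and (generic_grade iota subN idealI)
    (generic_and (generic_Ann iota subN)
      (generic_grade iota sub0 (is_ideal_Ann L))))).
apply: genericW => alpha [[A' AA'] [imA [gradeI [AnnL grade_Ann]]]].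
have phi_alpha : map_mx (spec iota alpha) A = A'.
  by apply/matrixP => i j; rewrite mxE (specE (AA' i j)).
have pi'_surj (y : spec_module iota alpha phi) : exists v, coker_pi _ v = y.
  by have [v ->] := coker_pi_surj y; exists v.
have pi'_ker v : coker_pi (spec_hom iota alpha phi) v = 0 <-> spec_sub N v.
  split=> [/coker_pi_eq0[w <-]|/(imA _ AA')[w <-]].
    by apply/(imA _ AA'); exists w; rewrite /= -/A phi_alpha.
  by apply/coker_pi_eq0; exists w; rewrite /= -/A phi_alpha.
split; first by move=> i j; exists (A' i j); apply: AA'.
  exact: (gradeI _ _ _ _ pi_surj piN pi'_surj pi'_ker).
(* With the annihilator of the specialized module rewritten as the specialization of Ann L, the
   claim is the grade lemma for the ring itself. *)
rewrite /grade_module (AnnL _ _ _ _ pi_surj piN pi'_surj pi'_ker).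
apply: (grade_Ann _ _ _ _ (@entry00_surj _) (@entry00_eq0 _) (@entry00_surj _)) => v.
split=> [/entry00_eq0->|[u -> uv]]; first by exists 0 => //; apply: is_spec_mx0.
by apply/entry00_eq0; apply: (is_spec_mx_uniq uv); apply: is_spec_mx0.
Qed.
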